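(* Let $\lambda>0$, let $\mathbf{x}_0\in\mathbb{R}^2$, let $(\rho_0,\theta_0)$ be the polar coordinates of $\mathbf{x}_0$ with respect to the origin, and let $0<R<|\mathbf{x}_0|=\rho_0$. Suppose that $$\phi(\mathbf{x})=\sum_{l=-\infty}^{\infty}\left(a_l Q_l(\rho')+b_l K_l(\lambda\rho')\right)e^{il\theta'},$$ where $(\rho',\theta')$ are the polar coordinates of $\mathbf{x}$ with respect to the point $\mathbf{x}_0$, is a multipole expansion (with complex coefficients $a_l,b_l$) of the potential due to a charge density which is contained inside the disk of radius $R$ about $\mathbf{x}_0$. Then, for $\mathbf{x}$ within the disk of radius $\rho_0-R$ about the origin, we have $$\phi(\mathbf{x})=\sum_{l=-\infty}^{\infty}\left(c_l P_l(\rho)+d_l(\lambda\rho)^{|l|}\right)e^{il\theta},$$ where $(\rho,\theta)$ are the polar coordinates of $\mathbf{x}$ with respect to the origin, and the coefficients are as follows. For all $l$, $$c_l=\sum_{m=-\infty}^{\infty}(-1)^m(a_m+b_m)K_{l-m}(\lambda\rho_0)e^{-i(l-m)\theta_0}.$$ For $l>0$, $$d_l=\frac{1}{2^l\,l!}\sum_{m=-\infty}^{0}(-1)^m\left(a_mQ_{l-m}(\rho_0)+b_mK_{l-m}(\lambda\rho_0)\right)e^{-i(l-m)\theta_0}+\frac{1}{2^l\,l!}\sum_{m=1}^{\infty}(-1)^m(a_m+b_m)K_{l-m}(\lambda\rho_0)e^{-i(l-m)\theta_0}.$$ For $l=0$, $$d_0=\sum_{m=-\infty}^{\infty}(-1)^m\left(a_mQ_{-m}(\rho_0)+b_mK_{-m}(\lambda\rho_0)\right)e^{im\theta_0}.$$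 For $l<0$, $$d_l=\frac{1}{2^{|l|}|l|!}\sum_{m=-\infty}^{-1}(-1)^m(a_m+b_m)K_{l-m}(\lambda\rho_0)e^{-i(l-m)\theta_0}+\frac{1}{2^{|l|}|l|!}\sum_{m=0}^{\infty}(-1)^m\left(a_mQ_{l-m}(\rho_0)+b_mK_{l-m}(\lambda\rho_0)\right)e^{-i(l-m)\theta_0}.$$
   Context: $I_n$ and $K_n$ ($n\in\mathbb{Z}$) are the modified Bessel functions of the first and second kind, with $I_{-n}=I_n$ and $K_{-n}=K_n$. For $r>0$ define $$Q_n(r)=K_n(\lambda r)-\frac{2^{|n|-1}(|n|-1)!}{\lambda^{|n|}r^{|n|}}\quad(n\neq0),\qquad Q_0(r)=K_0(\lambda r)+\log r,$$ and for $r\ge 0$, $n\in\mathbb{Z}$, define $$P_n(r)=I_n(\lambda r)-\left(\frac{\lambda r}{2}\right)^{|n|}\frac{1}{|n|!}.$$ Note that the factor $\lambda$ is already included in the definitions of $Q_n$ and $P_n$. The convention $0^0=1$ is used. The polar coordinates $(\rho',\theta')$ of $\mathbf{x}$ with respect to $\mathbf{x}_0$ are defined by $\mathbf{x}-\mathbf{x}_0=\rho'(\cos\theta',\sin\theta')$, and those with respect to the origin by $\mathbf{x}=\rho(\cos\theta,\sin\theta)$. The modified biharmonic equation is $\Delta(\Delta-\lambda^2)u=0$ in two dimensions, with free-space Green's function $\mathcal{G}(\mathbf{x},\mathbf{y})=-\frac{1}{2\pi\lambda^2}\left(K_0(\lambda|\mathbf{x}-\mathbf{y}|)+\log|\mathbf{x}-\mathbf{y}|\right)$.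 The potential due to a charge density contained in a disk is a superposition, over source points $\mathbf{y}$ in that disk, of $\mathcal{G}(\mathbf{x},\mathbf{y})$ and its first- and second-order directional derivatives. A multipole expansion of this potential is a series of the displayed form that converges absolutely to the potential at every $\mathbf{x}$ outside the disk. ''Within the disk of radius $\rho_0-R$'' means $|\mathbf{x}|<\rho_0-R$. *)

(* Defs.v *)
From HB Require Import structures.
From mathcomp Require Import all_boot all_order all_algebra.
From mathcomp Require Import complex.
From mathcomp Require Import all_classical all_reals all_analysis.

Set Implicit Arguments.
Unset Strict Implicit.
Unset Printing Implicit Defensive.

Import Order.TTheory GRing.Theory Num.Theory.
Import numFieldNormedType.Exports.

Local Open Scope classical_set_scope.
Local Open Scope ring_scope.
Local Open Scope complex_scope.

Definition besselI (R : realType) (n : int) (z : R) : R :=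
  limn (series (fun k : nat =>
    (z / 2) ^+ (2 * k + `|n|)%N / (k`!%:R * (k + `|n|)`!%:R))).

Definition cosh (R : realType) (t : R) : R := (expR t + expR (- t)) / 2.

(* The standard integral representation, valid for z > 0, serves as the
   definition; at z <= 0 the value is meaningless. *)
Definition besselK (R : realType) (n : int) (z : R) : R :=
  \int[lebesgue_measure]_(t in `[0%R, +oo[)
    (expR (- (z * cosh t)) * cosh (n%:~R * t)).

Definition Qn (R : realType) (lam : R) (n : int) (r : R) : R :=
  if n == 0 then besselK 0 (lam * r) + ln r
  else besselK n (lam * r)
       - (2 ^+ `|n|.-1 * (`|n|.-1)`!%:R) / (lam ^+ `|n| * r ^+ `|n|).

Definition Pn (R : realType) (lam : R) (n : int) (r : R) : R :=
  besselI n (lam * r) - (lam * r / 2) ^+ `|n| / (absz n)`!%:R.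

(* The Euclidean norm; the library norm on R * R is the sup norm. *)
Definition enorm (R : realType) (x : R * R) : R :=
  Num.sqrt (x.1 ^+ 2 + x.2 ^+ 2).

(* (r, t) are polar coordinates of x with respect to c. The angle is only
   determined modulo 2 pi, and is arbitrary when x = c. *)
Definition polar_coords (R : realType) (c x : R * R) (r t : R) : Prop :=
  0 <= r /\ x - c = (r * cos t, r * sin t).

Definition expi (R : realType) (t : R) : R[i] := cos t +i* sin t.

(* Series over m, m+1, ... ; over m, m-1, ... ; and over all integers, the
   latter converging when both of its halves do. *)
Definition sum_ge (R : realType) (m : int) (f : int -> R[i]) (s : R[i]) : Prop :=
  series (fun k : nat => f (m + k%:Z) : R[i]^o) @ \oo --> (s : R[i]^o).

Definition sum_le (R : realType) (m : int) (f : int -> R[i]) (s : R[i]) : Prop :=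
  series (fun k : nat => f (m - k%:Z) : R[i]^o) @ \oo --> (s : R[i]^o).

Definition sum_Z (R : realType) (f : int -> R[i]) (s : R[i]) : Prop :=
  exists s1 s2 : R[i], [/\ sum_le (-1) f s1, sum_ge 0 f s2 & s = s1 + s2].

Definition abs_summable_Z (R : realType) (f : int -> R[i]) : Prop :=
  exists s : R[i], sum_Z (fun l => `|f l|) s.

Definition disk (R : realType) (c : R * R) (r : R) : set (R * R) :=
  [set y | enorm (y - c) <= r].

Definition green (R : realType) (lam : R) (x y : R * R) : R :=
  - (2 * pi * lam ^+ 2)^-1
    * (besselK 0 (lam * enorm (x - y)) + ln (enorm (x - y))).

Definition Cintegrable (R : realType) (d : measure_display)
    (T : measurableType d) (mu : {measure set T -> \bar R}) (D : set T)
    (f : T -> R[i]) : Prop :=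
  mu.-integrable D (EFin \o (fun y => complex.Re (f y))) /\
  mu.-integrable D (EFin \o (fun y => complex.Im (f y))).

Definition Cintegral (R : realType) (d : measure_display)
    (T : measurableType d) (mu : {measure set T -> \bar R}) (D : set T)
    (f : T -> R[i]) : R[i] :=
  (\int[mu]_(y in D) complex.Re (f y)) +i* (\int[mu]_(y in D) complex.Im (f y)).

Definition basis2 (R : realType) (i : 'I_2) : R * R :=
  ((i == 0)%:R, (i == 1)%:R).

(* The sources are given by complex densities with respect to a finite Borel
   measure mu, which may be singular (points, curves): a charge density sigma,
   a dipole moment p and a quadrupole moment q. The derivatives act on the
   source point. A derivative along a direction v(y), or along v(y) and then
   w(y), is the case p i = p0 * v_i, resp. q i j = q0 * v_i * w_j. *)
Definition is_potential_of_disk (R : realType) (lam : R) (c : R * R) (r : R)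
    (phi : R * R -> R[i]) : Prop :=
  exists (mu : {finite_measure set (R * R)%type -> \bar R})
         (sigma : R * R -> R[i]) (p : 'I_2 -> R * R -> R[i])
         (q : 'I_2 -> 'I_2 -> R * R -> R[i]),
    [/\ Cintegrable mu (disk c r) sigma,
        forall i, Cintegrable mu (disk c r) (p i),
        forall i j, Cintegrable mu (disk c r) (q i j)
      & forall x, ~ disk c r x ->
          phi x = Cintegral mu (disk c r) (fun y =>
            sigma y * (green lam x y)%:C
            + \sum_i p i y * ('D_(basis2 R i) (green lam x) y)%:C
            + \sum_i \sum_j q i j y *
                ('D_(basis2 R i) ('D_(basis2 R j) (green lam x)) y)%:C)].

Definition is_multipole_expansion (R : realType) (lam : R) (c : R * R) (r : R)
    (a b : int -> R[i]) (phi : R * R -> R[i]) : Prop :=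
  forall (x : R * R) (rho' theta' : R),
    ~ disk c r x -> polar_coords c x rho' theta' ->
    let term l := (a l * (Qn lam l rho')%:C
                   + b l * (besselK l (lam * rho'))%:C)
                  * expi (l%:~R * theta') in
    abs_summable_Z term /\ sum_Z term (phi x).

(* Main.v *)
Require Import Defs.
From HB Require Import structures.
From mathcomp Require Import all_boot all_order all_algebra.
From mathcomp Require Import complex.
From mathcomp Require Import all_classical all_reals all_analysis.
From mathcomp Require Import measurable_realfun.
From mathcomp Require Import ring lra zify.

(** The multipole expansion and the local expansion are the row sums and the
    column sums of one absolutely summable family indexed by pairs [(m, l)] of
    integers.

    Write [A = a + b] and split [Qn] into [K] and a harmonic part [Qharm], so
    that the multipole of order [m] is [A m K_m + a m Qharm_m]. At a point with
    [|x| < rho0] each of the two parts has an expansion about the origin. For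
    [K_m] this is Graf's addition theorem (has_sum_graf_polar): under the
    integral that defines [K] the series is the generating function of the
    functions [I], and a shift of the line of integration (Rintegral_contour)
    brings the sum back to the integral of [K_m]. For the harmonic part it is
    the binomial series of [(1 - w)^-n], or for [m = 0] the series of
    [log |1 - w|], where [w] is the quotient of the complex coordinates of [x]
    and [x0] (has_sum_harm_term, has_sum_harm_term0). Regrouped by the order
    [l], with [I_l] split into [P_l] and its leading power, these expansions
    are the local expansion and its coefficients.

    Fubini's theorem for unconditional sums (has_sum_fubini) allows the exchange
    as soon as the family is absolutely summable. The absolute row sums are
    given by the aligned case, in which [x] lies on the segment from the origin
    to [x0]: they are [|A m|] times [K_m] and [|a m|] times the harmonic radial
    function at the distance [rho0 - |x|], which is larger than the radius of
    the disk. What is left is that each of the two families of row sums is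
    summable, although the hypothesis controls only the sum of the two parts,
    which nearly cancel for large [m]. The values at two radii determine both
    coefficients; the determinant of this system is bounded below by a multiple
    of [1/|m|] because [z ^ n K_n z] strictly decreases at a controlled rate
    (scaledK_gap), and a third, larger radius turns the resulting bounds
    into geometric ones (expansion_bounds). *)

Import Order.TTheory GRing.Theory Num.Theory.
Import numFieldNormedType.Exports.

Set Implicit Arguments.
Unset Strict Implicit.
Unset Printing Implicit Defensive.

Local Open Scope classical_set_scope.
Local Open Scope ring_scope.
Local Open Scope complex_scope.

(** * Unconditional summation *)

Section HasSum.
Context {K : numFieldType}.
Implicit Types (T U : choiceType).

Definition sum_bounded T (f : T -> K) : Prop :=
  exists M : K, forall B : seq T, uniq B -> \sum_(i <- B) `|f i| <= M.

(** The first clause is absolute summability. The second one is convergence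
    along the inclusion of finite sets, with no enumeration of the indices,
    which is what rearrangements of double series require. *)
Definition has_sum T (f : T -> K) (s : K) : Prop :=
  sum_bounded f /\
  forall e : K, 0 < e -> exists A : seq T, forall B : seq T,
    uniq B -> {subset A <= B} -> `|\sum_(i <- B) f i - s| <= e.

Lemma uniq_sum_split T (B C : seq T) (f : T -> K) : uniq B -> uniq C ->
  {subset B <= C} ->
  \sum_(i <- C) f i = \sum_(i <- B) f i + \sum_(i <- C | i \notin B) f i.
Proof.
move=> uB uC sBC; rewrite (bigID (mem B)) /=; congr (_ + _).
rewrite -big_filter; apply: perm_big; apply: uniq_perm => //.
  exact: filter_uniq.
by move=> i; rewrite mem_filter /= andb_idr //; exact: sBC.
Qed.

Lemma ler_sum_subset T (B C : seq T) (f : T -> K) : (forall i, 0 <= f i) ->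
  uniq B -> uniq C -> {subset B <= C} ->
  \sum_(i <- B) f i <= \sum_(i <- C) f i.
Proof.
move=> f0 uB uC sBC; rewrite (uniq_sum_split f uB uC sBC) lerDl.
by apply: sumr_ge0.
Qed.

Lemma sum_bounded_le T (f g : T -> K) :
  (forall i, `|f i| <= `|g i|) -> sum_bounded g -> sum_bounded f.
Proof.
move=> fg [M hM]; exists M => B uB; apply: le_trans (hM B uB).
by apply: ler_sum => i _; exact: fg.
Qed.

Lemma sum_boundedZ T (f : T -> K) (c : K) :
  sum_bounded f -> sum_bounded (fun i => c * f i).
Proof.
move=> [M hM]; exists (`|c| * M) => B uB.
under eq_bigr do rewrite normrM.
by rewrite -mulr_sumr ler_wpM2l // hM.
Qed.

Lemma sum_boundedD T (f g : T -> K) :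
  sum_bounded f -> sum_bounded g -> sum_bounded (fun i => f i + g i).
Proof.
move=> [M hM] [N hN]; exists (M + N) => B uB.
apply: le_trans (lerD (hM B uB) (hN B uB)).
by rewrite -big_split /=; apply: ler_sum => i _; exact: ler_normD.
Qed.

Lemma has_sum_bounded T (f : T -> K) s : has_sum f s -> sum_bounded f.
Proof. by case. Qed.

Lemma has_sum_uniq T (f : T -> K) s1 s2 :
  has_sum f s1 -> has_sum f s2 -> s1 = s2.
Proof.
move=> [_ h1] [_ h2]; apply/eqP; rewrite -subr_eq0 -normr_le0.
apply/ler_addgt0Pr => e e0; rewrite add0r.
have e20 : 0 < e / 2 by rewrite divr_gt0.
have [A1 hA1] := h1 _ e20; have [A2 hA2] := h2 _ e20.
pose B := undup (A1 ++ A2).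
have uB : uniq B by exact: undup_uniq.
have s1B : {subset A1 <= B} by move=> i iA; rewrite mem_undup mem_cat iA.
have s2B : {subset A2 <= B} by move=> i iA; rewrite mem_undup mem_cat iA orbT.
have := lerD (hA1 B uB s1B) (hA2 B uB s2B); rewrite -splitr; apply: le_trans.
by rewrite [X in _ <= X + _]distrC ler_distD.
Qed.

Lemma has_sumZ T (f : T -> K) s (c : K) :
  has_sum f s -> has_sum (fun i => c * f i) (c * s).
Proof.
move=> [bf hf]; split; first exact: sum_boundedZ.
move=> e e0.
have c0 : 0 < `|c| + 1 by rewrite ltr_wpDl.
have [A hA] := hf (e / (`|c| + 1)) (divr_gt0 e0 c0).
exists A => B uB sAB; rewrite -mulr_sumr -mulrBr normrM.
apply: (@le_trans _ _ ((`|c| + 1) * `|\sum_(i <- B) f i - s|)).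
  by rewrite ler_wpM2r // lerDl.
by rewrite mulrC -ler_pdivlMr // hA.
Qed.

Lemma has_sumD T (f g : T -> K) s t :
  has_sum f s -> has_sum g t -> has_sum (fun i => f i + g i) (s + t).
Proof.
move=> [bf hf] [bg hg]; split; first exact: sum_boundedD.
move=> e e0; have e20 : 0 < e / 2 by rewrite divr_gt0.
have [A1 hA1] := hf _ e20; have [A2 hA2] := hg _ e20.
exists (A1 ++ A2) => B uB sB.
have s1B : {subset A1 <= B} by move=> i iA; apply: sB; rewrite mem_cat iA.
have s2B : {subset A2 <= B} by move=> i iA; apply: sB; rewrite mem_cat iA orbT.
have := lerD (hA1 B uB s1B) (hA2 B uB s2B); rewrite -splitr; apply: le_trans.
by rewrite big_split /= opprD addrACA ler_normD.
Qed.

Lemma eq_has_sum T (f g : T -> K) s : f =1 g -> has_sum f s -> has_sum g s.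
Proof. by move=> /funext ->. Qed.

Lemma has_sum_fin T (f : T -> K) (A : seq T) : uniq A ->
  (forall i, i \notin A -> f i = 0) -> has_sum f (\sum_(i <- A) f i).
Proof.
move=> uA f0; split.
  exists (\sum_(i <- A) `|f i|) => B uB.
  rewrite (bigID (mem A)) /= [X in _ + X]big1 ?addr0; last first.
    by move=> i iA; rewrite f0 // normr0.
  rewrite -big_filter; apply: ler_sum_subset => //; first exact: filter_uniq.
  by move=> i; rewrite mem_filter => /andP[].
move=> e e0; exists A => B uB sAB; rewrite (uniq_sum_split f uA uB sAB).
by rewrite addrAC subrr add0r big1 ?normr0 ?ltW.
Qed.

(** The inverse of the injection is partial, so that the same lemma serves
    bijections, shifts and half lines of integers: off the range of the
    injection the family vanishes. *)
Lemma has_sum_reindex T U (e : U -> T) (g : T -> option U) (f : T -> K) s :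
  pcancel e g -> (forall t, g t = None -> f t = 0) ->
  (forall t u, g t = Some u -> e u = t) ->
  has_sum (f \o e) s <-> has_sum f s.
Proof.
move=> eK f0 gK.
have sumE (h : T -> K) (B : seq T) : (forall t, g t = None -> h t = 0) ->
    \sum_(i <- B) h i = \sum_(u <- pmap g B) h (e u).
  move=> h0; elim: B => [|t B IH] /=; first by rewrite !big_nil.
  rewrite big_cons IH; case gt: (g t) => [u|] /=.
    by rewrite big_cons (gK _ _ gt).
  by rewrite h0 // add0r.
have upmap (B : seq T) : uniq B -> uniq (pmap g B).
  elim: B => [//|t B IH] /= /andP[tB /IH uB].
  case gt: (g t) => [u|] //=; rewrite uB andbT.
  apply: contra tB; rewrite mem_pmap => /mapP[t' t'B /esym gt'].
  by rewrite -(gK _ _ gt) (gK _ _ gt').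
have einj : injective e by exact: pcan_inj eK.
have pmapK (B : seq U) : pmap g (map e B) = B.
  by elim: B => //= u B IH; rewrite eK /= IH.
have umap (B : seq U) : uniq (map e B) = uniq B by exact: map_inj_uniq.
split=> -[[M hM] hs]; split.
- exists M => B uB; rewrite sumE => [|t gt]; last by rewrite f0 // normr0.
  exact/hM/upmap.
- move=> e' e0; have [A hA] := hs _ e0; exists (map e A) => B uB sAB.
  rewrite sumE //; apply: hA; first exact: upmap.
  move=> u uA; rewrite mem_pmap -eK; apply: map_f; apply: sAB.
  exact: map_f.
- exists M => B uB; have := hM (map e B); rewrite umap => /(_ uB).
  by rewrite big_map.
- move=> e' e0; have [A hA] := hs _ e0; exists (pmap g A) => B uB sAB.
  have := hA (undup (A ++ map e B)) (undup_uniq _).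
  have sA : {subset A <= undup (A ++ map e B)}.
    by move=> t tA; rewrite mem_undup mem_cat tA.
  move=> /(_ sA); rewrite sumE // (perm_big B) //=.
  apply: uniq_perm => //; first by apply: upmap; exact: undup_uniq.
  move=> u; rewrite mem_pmap; apply/mapP/idP => [[t]|uB'].
    rewrite mem_undup mem_cat => /orP[tA gt|/mapP[v vB ->]].
      by apply: sAB; rewrite mem_pmap gt map_f.
    by rewrite eK => -[->].
  by exists (e u); rewrite ?eK // mem_undup mem_cat map_f // orbT.
Qed.

Lemma has_sum_bij T U (e : U -> T) (g : T -> U) (f : T -> K) s :
  cancel e g -> cancel g e -> has_sum (f \o e) s <-> has_sum f s.
Proof.
move=> eK gK; apply: (@has_sum_reindex _ _ _ (Some \o g)) => //=.
  by move=> u /=; rewrite eK.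
by move=> t u [<-].
Qed.

(** A finite set of pairs lies in a finite rectangle. *)
Lemma sum_bounded_prod T U (F : T * U -> K) (G : T -> K) :
  (forall t (C : seq U), uniq C -> \sum_(u <- C) `|F (t, u)| <= G t) ->
  sum_bounded G -> sum_bounded F.
Proof.
move=> FG [M hM]; exists M => B uB.
pose B1 := undup (map fst B); pose B2 := undup (map snd B).
apply: (@le_trans _ _ (\sum_(p <- [seq (t, u) | t <- B1, u <- B2]) `|F p|)).
  apply: ler_sum_subset => //.
    by apply: allpairs_uniq; rewrite ?undup_uniq // => -[? ?] [? ?] _ _ [-> ->].
  move=> [t u] tuB; apply/allpairsP; exists (t, u); split=> //=.
    by rewrite mem_undup; apply/mapP; exists (t, u).
  by rewrite mem_undup; apply/mapP; exists (t, u).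
rewrite big_allpairs; apply: le_trans (hM B1 (undup_uniq _)).
apply: ler_sum => t _.
apply: le_trans (FG t _ (undup_uniq _)) _.
apply: real_ler_norm; apply: ger0_real.
by apply: le_trans (FG t [::] isT); rewrite big_nil.
Qed.

(** A finite set of rows is approximated through one finite set of columns,
    large enough for all these rows and for the total sum; the sum over the
    resulting finite rectangle is compared with both sides. *)
Lemma has_sum_fubini T U (F : T * U -> K) (g : T -> K) s :
  has_sum F s -> (forall t, has_sum (fun u => F (t, u)) (g t)) -> has_sum g s.
Proof.
move=> [[M hM] hF] hg.
have uprod (B : seq T) (C : seq U) : uniq B -> uniq C ->
    uniq [seq (t, u) | t <- B, u <- C].
  by move=> uB uC; apply: allpairs_uniq => // -[? ?] [? ?] _ _ [-> ->].
have approx (B : seq T) (A : seq U) (e : K) : 0 < e -> exists C : seq U,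
    [/\ uniq C, {subset A <= C} &
        forall t, t \in B -> `|\sum_(u <- C) F (t, u) - g t| <= e].
  move=> e0.
  have /choice[Q hQ] t := (hg t).2 _ e0.
  exists (undup (A ++ flatten (map Q B))); split; first exact: undup_uniq.
    by move=> u uA; rewrite mem_undup mem_cat uA.
  move=> t tB; apply: hQ; first exact: undup_uniq.
  move=> u uQ; rewrite mem_undup mem_cat; apply/orP; right.
  by apply/flattenP; exists (Q t) => //; exact: map_f.
have sumsum (B : seq T) (e : K) : 0 < e -> exists2 e1 : K, 0 < e1 &
    \sum_(t <- B) e1 <= e.
  move=> e0; exists (e / (size B).+1%:R); first by rewrite divr_gt0 // ltr0Sn.
  rewrite big_const_seq count_predT iter_addr addr0 -[X in X <= _]mulr_natr.
  rewrite -mulrA ler_piMr ?(ltW e0) // mulrC ler_pdivrMr ?ltr0Sn //.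
  by rewrite mul1r ler_nat.
split.
  exists M => B uB; apply/ler_addgt0Pr => e e0.
  have [e1 e10 he1] := sumsum B e e0.
  have [C [uC _ hC]] := approx B [::] e1 e10.
  apply: (@le_trans _ _
    (\sum_(t <- B) (\sum_(u <- C) `|F (t, u)| + e1))).
    rewrite big_seq [X in _ <= X]big_seq; apply: ler_sum => t tB.
    rewrite -[g t](subrK (\sum_(u <- C) F (t, u))) addrC.
    apply: le_trans (ler_normD _ _) (lerD _ _); first exact: ler_norm_sum.
    by rewrite distrC; exact: hC.
  rewrite big_split /=; apply: lerD => //.
  by have := hM _ (uprod _ _ uB uC); rewrite big_allpairs.
move=> e e0; have e20 : 0 < e / 2 by rewrite divr_gt0.
have [A hA] := hF _ e20; exists (map fst A) => B uB sAB.
have [e1 e10 he1] := sumsum B _ e20.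
have [C [uC sC hC]] := approx B (map snd A) e1 e10.
have sAP : {subset A <= [seq (t, u) | t <- B, u <- C]}.
  move=> [t u] tuA; apply/allpairsP; exists (t, u); split=> //=.
    by apply: sAB; apply/mapP; exists (t, u).
  by apply: sC; apply/mapP; exists (t, u).
have := hA _ (uprod _ _ uB uC) sAP; rewrite big_allpairs => h2.
rewrite [e]splitr.
apply: le_trans (ler_distD (\sum_(t <- B) \sum_(u <- C) F (t, u)) _ _) _.
apply: lerD => //; apply: le_trans he1; rewrite -sumrB.
apply: le_trans (ler_norm_sum _ _ _) _.
rewrite big_seq [X in _ <= X]big_seq; apply: ler_sum => t tB.
by rewrite distrC; exact: hC.
Qed.

Lemma has_sum_fubini2 T U (F : T * U -> K) (g : U -> K) s :
  has_sum F s -> (forall u, has_sum (fun t => F (t, u)) (g u)) -> has_sum g s.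
Proof.
move=> hF hg.
apply: (@has_sum_fubini U T (fun p => F (p.2, p.1))) => //.
by apply/(@has_sum_bij _ _ (fun p => (p.2, p.1)) (fun p => (p.2, p.1)) F s) => //
  => -[].
Qed.

End HasSum.

Section RealSums.
Context {R : realType}.
Implicit Types (T U : choiceType).

Lemma has_sum_ge0 T (f : T -> R) s (B : seq T) : (forall i, 0 <= f i) ->
  has_sum f s -> uniq B -> \sum_(i <- B) f i <= s.
Proof.
move=> f0 [_ hf] uB; apply/ler_addgt0Pr => e e0.
have [A hA] := hf _ e0.
have := hA (undup (A ++ B)) (undup_uniq _).
have sA : {subset A <= undup (A ++ B)}.
  by move=> t tA; rewrite mem_undup mem_cat tA.
move=> /(_ sA) h.
apply: (@le_trans _ _ (\sum_(i <- undup (A ++ B)) f i)).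
  apply: ler_sum_subset => //; first exact: undup_uniq.
  by move=> t tB; rewrite mem_undup mem_cat tB orbT.
by rewrite -lerBlDl; apply: le_trans h; exact: ler_norm.
Qed.

(** For a nonnegative family the sum is the supremum of the finite sums; in
    general [f = (f + |f|) - |f|]. *)
Lemma sum_bounded_has_sum T (f : T -> R) : sum_bounded f ->
  exists s, has_sum f s.
Proof.
have pos (g : T -> R) : (forall i, 0 <= g i) -> sum_bounded g ->
    exists s, has_sum g s.
  move=> g0 bg; have [M hM] := bg.
  pose S := [set x | exists2 B : seq T, uniq B & x = \sum_(i <- B) g i].
  have ubS : ubound S M.
    move=> _ [B uB ->]; have := hM _ uB; apply: le_trans.
    by apply: ler_sum => i _; exact: ler_norm.
  have hS : has_sup S.
    by split; [exists 0; exists [::]; rewrite ?big_nil | exists M].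
  exists (sup S); split=> // e e0.
  have [_ [A uA ->] hA] := sup_adherent e0 hS.
  exists A => B uB sAB.
  have h1 : \sum_(i <- A) g i <= \sum_(i <- B) g i by exact: ler_sum_subset.
  have h2 : \sum_(i <- B) g i <= sup S.
    by apply: ub_le_sup; [exists M | exists B].
  rewrite ler_norml; apply/andP; split; lra.
move=> bf.
have bn : sum_bounded (fun i => `|f i|).
  by apply: sum_bounded_le bf => i; rewrite normr_id.
have [s1 h1] := pos _ (fun i => normr_ge0 (f i)) bn.
have [|s2 h2] := pos (fun i => f i + `|f i|) _ (sum_boundedD bf bn).
  by move=> i; rewrite -lerBlDr sub0r lerNl -normrN ler_norm.
exists (s2 + -1 * s1).
apply: eq_has_sum (has_sumD h2 (has_sumZ (-1) h1)) => i /=; ring.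
Qed.

Lemma complex_eq (x y : R[i]) : complex.Re x = complex.Re y ->
  complex.Im x = complex.Im y -> x = y.
Proof. by case: x y => [a b] [c d] /= -> ->. Qed.

Lemma normC_real (x : R) : `|x%:C| = (`|x|%:C : R[i]).
Proof. by rewrite normc_def /= expr0n /= addr0 sqrtr_sqr. Qed.

Lemma normC_Re (z : R[i]) : `|z| = (complex.Re `|z|)%:C.
Proof. by rewrite normc_def. Qed.

Lemma normC_Re_le (z : R[i]) : `|(complex.Re z)%:C| <= `|z|.
Proof.
rewrite normC_real normc_def lecR -sqrtr_sqr ler_sqrt ?sqr_ge0 //.
  by rewrite lerDl sqr_ge0.
by rewrite addr_ge0 // sqr_ge0.
Qed.

Lemma normC_Im_le (z : R[i]) : `|(complex.Im z)%:C| <= `|z|.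
Proof.
rewrite normC_real normc_def lecR -sqrtr_sqr ler_sqrt ?sqr_ge0 //.
  by rewrite lerDr sqr_ge0.
by rewrite addr_ge0 // sqr_ge0.
Qed.

Lemma ReD (x y : R[i]) :
  complex.Re (x + y) = complex.Re x + complex.Re y.
Proof. by case: x; case: y. Qed.

Lemma Re_sum (I : Type) (B : seq I) (f : I -> R[i]) :
  complex.Re (\sum_(i <- B) f i) = \sum_(i <- B) complex.Re (f i).
Proof. exact: (big_morph _ ReD erefl). Qed.

Lemma sumC (I : Type) (B : seq I) (f : I -> R) :
  \sum_(i <- B) (f i)%:C = (\sum_(i <- B) f i)%:C :> R[i].
Proof. by rewrite rmorph_sum. Qed.

Lemma has_sum_Re T (f : T -> R[i]) s : has_sum f s ->
  has_sum (fun i => complex.Re (f i)) (complex.Re s).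
Proof.
move=> [[M hM] hf]; split.
  exists (complex.Re M) => B uB; have := hM B uB.
  rewrite lecE => /andP[_]; apply: le_trans; rewrite Re_sum.
  apply: ler_sum => i _; have := normC_Re_le (f i).
  by rewrite normC_real (normC_Re (f i)) lecR.
move=> e e0; have [|A hA] := hf e%:C; first by rewrite ltcR.
exists A => B uB sAB; have := hA B uB sAB.
rewrite -Re_sum => h; rewrite -lecR -normC_real; apply: le_trans h.
apply: le_trans (normC_Re_le _); rewrite ReD.
by case: s {hf hA} => a b.
Qed.

Lemma has_sum_real_complex T (f : T -> R) s : has_sum f s ->
  has_sum (fun i => (f i)%:C : R[i]) s%:C.
Proof.
move=> [[M hM] hf]; split.
  exists M%:C => B uB; under eq_bigr do rewrite normC_real.
  by rewrite sumC lecR hM.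
move=> e e0; have eE : e = (complex.Re e)%:C.
  by rewrite RRe_real // gtr0_real.
have [|A hA] := hf (complex.Re e); first by rewrite -ltcR -eE.
exists A => B uB sAB; rewrite sumC -rmorphB normC_real eE lecR.
exact: hA.
Qed.

Lemma has_sum_complex T (f : T -> R[i]) a b :
  has_sum (fun i => complex.Re (f i)) a ->
  has_sum (fun i => complex.Im (f i)) b -> has_sum f (a +i* b).
Proof.
move=> /has_sum_real_complex ha /has_sum_real_complex hb.
rewrite [a +i* b]complexE; apply: eq_has_sum (has_sumD ha (has_sumZ 'i%C hb)).
by move=> i; rewrite -complexE.
Qed.

Lemma sum_bounded_normC T (f : T -> R[i]) :
  sum_bounded f <-> sum_bounded (fun i => complex.Re `|f i|).
Proof.
split=> -[M hM].
  exists (complex.Re M) => B uB; have := hM B uB.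
  rewrite lecE => /andP[_]; apply: le_trans; rewrite Re_sum.
  apply: ler_sum => i _; rewrite ger0_norm //.
  by have := normr_ge0 (f i); rewrite lecE => /andP[].
exists M%:C => B uB; under eq_bigr do rewrite normC_Re.
rewrite sumC lecR; apply: le_trans (hM B uB).
by apply: ler_sum => i _; exact: ler_norm.
Qed.

Lemma sum_bounded_has_sumC T (f : T -> R[i]) : sum_bounded f ->
  exists s, has_sum f s.
Proof.
move=> /sum_bounded_normC bf.
have [|a ha] := @sum_bounded_has_sum _ (fun i => complex.Re (f i)).
  apply: sum_bounded_le bf => i; have := normC_Re_le (f i).
  rewrite normC_real (normC_Re (f i)) lecR => /le_trans; apply.
  exact: ler_norm.
have [|b hb] := @sum_bounded_has_sum _ (fun i => complex.Im (f i)).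
  apply: sum_bounded_le bf => i; have := normC_Im_le (f i).
  rewrite normC_real (normC_Re (f i)) lecR => /le_trans; apply.
  exact: ler_norm.
by exists (a +i* b); exact: has_sum_complex.
Qed.

(** Fubini's theorem for the family that carries [f t] at the point [(t, h t)]
    of the product and vanishes elsewhere. *)
Lemma has_sum_fibre T U (h : T -> U) (f : T -> R[i]) (g : U -> R[i]) s :
  has_sum f s ->
  (forall u, has_sum (fun t => if h t == u then f t else 0) (g u)) ->
  has_sum g s.
Proof.
move=> hf hg; pose F (p : T * U) := if h p.1 == p.2 then f p.1 else 0.
have row t : has_sum (fun u => F (t, u)) (f t).
  have := @has_sum_fin _ _ (fun u => F (t, u)) [:: h t] isT.
  rewrite big_seq1 /F /= eqxx; apply => u.
  by rewrite mem_seq1 eq_sym => /negbTE ->.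
have [|S hS] := @sum_bounded_has_sumC _ F.
  apply: (@sum_bounded_prod _ _ _ _ (fun t => `|f t|)).
    move=> t B uB; rewrite /F /=; have [tB|tB] := boolP (h t \in B).
      rewrite (bigD1_seq (h t)) //= eqxx big1 ?addr0 // => u.
      by rewrite eq_sym => /negbTE ->; rewrite normr0.
    rewrite big_seq big1 // => u uB'; case: eqP => [E|_]; last by rewrite normr0.
    by rewrite E uB' in tB.
  by apply: sum_bounded_le (has_sum_bounded hf) => t; rewrite normr_id.
rewrite (has_sum_uniq hf (has_sum_fubini hS row)).
exact: has_sum_fubini2 hS hg.
Qed.

Lemma has_sum_prod T U (f : T -> R[i]) (g : U -> R[i]) s t :
  has_sum f s -> has_sum g t ->
  has_sum (fun p : T * U => f p.1 * g p.2) (s * t).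
Proof.
move=> hf hg.
have [|S hS] := @sum_bounded_has_sumC _ (fun p : T * U => f p.1 * g p.2).
  have [N hN] := has_sum_bounded hg.
  apply: (@sum_bounded_prod _ _ _ _ (fun t => N * `|f t|)).
    move=> i B uB /=; under eq_bigr do rewrite normrM.
    by rewrite -mulr_sumr mulrC ler_wpM2r // hN.
  apply: sum_boundedZ; apply: sum_bounded_le (has_sum_bounded hf) => i.
  by rewrite normr_id.
rewrite (@has_sum_uniq _ _ (fun i => f i * t) (s * t) S) //.
  by have := has_sumZ t hf; rewrite mulrC; apply: eq_has_sum => i; rewrite mulrC.
by apply: has_sum_fubini hS _ => i /=; exact: has_sumZ.
Qed.

End RealSums.

(** * Unconditional sums and series *)

Section Series.

Lemma has_sum_series {K : numFieldType} (f : nat -> K) s : has_sum f s ->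
  series (f : nat -> K^o) @ \oo --> (s : K^o).
Proof.
move=> [_ hf]; apply/cvgrPdist_le => e e0; have [A hA] := hf _ e0.
near=> n; rewrite distrC /series /=; apply: hA; first exact: iota_uniq.
have hn : (\max_(i <- A) i < n)%N by near: n; exact: nbhs_infty_gt.
move=> i iA; rewrite mem_index_iota /=; apply: leq_ltn_trans hn.
exact: leq_bigmax_seq.
Unshelve. all: by end_near. Qed.

Context {R : realType}.

(** Every finite set of indices is contained in an initial segment. *)
Lemma sum_bounded_series {K : numFieldType} (f : nat -> K) (M : K) :
  (forall N, \sum_(0 <= k < N) `|f k| <= M) -> sum_bounded f.
Proof.
move=> hM; exists M => B uB; apply: le_trans (hM (\max_(i <- B) i).+1).
apply: ler_sum_subset => //; first exact: iota_uniq.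
by move=> i iB; rewrite mem_index_iota /= ltnS; exact: leq_bigmax_seq.
Qed.

Lemma has_sum_limn (f : nat -> R) : cvgn (series (fun n => `|f n|)) ->
  has_sum f (limn (series f)).
Proof.
move=> cf.
have [|s hs] := @sum_bounded_has_sum _ _ f.
  apply: (@sum_bounded_series _ _ (limn (series (fun n => `|f n|)))) => N.
  apply: nondecreasing_cvgn_le => // m n mn.
  rewrite /series /= (big_cat_nat (leq0n m) mn) /= lerDl.
  exact: sumr_ge0.
by have /cvg_lim -> := has_sum_series hs.
Qed.

Lemma has_sum_restr (T : choiceType) (P : pred T) (f : T -> R[i]) s : has_sum f s ->
  exists s', has_sum (fun i => if P i then f i else 0) s'.
Proof.
move=> hf; apply: sum_bounded_has_sumC; apply: sum_bounded_le (has_sum_bounded hf).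
by move=> i; case: ifP => // _; rewrite normr0.
Qed.

Lemma has_sum_ge (m : int) (f : int -> R[i]) s :
  has_sum (fun l => if m <= l then f l else 0) s -> sum_ge m f s.
Proof.
move=> hf; apply: has_sum_series.
have := @has_sum_reindex _ _ _ (fun k : nat => m + k%:Z)
  (fun l => if m <= l then Some `|l - m|%N else None)
  (fun l => if m <= l then f l else 0) s.
case.
- by move=> k /=; rewrite lerDl /= addrC addKr absz_nat.
- by move=> l; case: ifP.
- by move=> l k; case: ifP => // ml [<-]; lia.
by move=> _ /(_ hf); apply: eq_has_sum => k /=; rewrite lerDl.
Qed.

Lemma has_sum_le (m : int) (f : int -> R[i]) s :
  has_sum (fun l => if l <= m then f l else 0) s -> sum_le m f s.
Proof.
move=> hf; apply: has_sum_series.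
have := @has_sum_reindex _ _ _ (fun k : nat => m - k%:Z)
  (fun l => if l <= m then Some `|m - l|%N else None)
  (fun l => if l <= m then f l else 0) s.
case.
- by move=> k /=; rewrite gerDl oppr_le0 /= opprB addrC subrK absz_nat.
- by move=> l; case: ifP.
- by move=> l k; case: ifP => // ml [<-]; lia.
by move=> _ /(_ hf); apply: eq_has_sum => k /=; rewrite gerDl oppr_le0.
Qed.

Lemma has_sum_Z (f : int -> R[i]) s : has_sum f s -> sum_Z f s.
Proof.
move=> hf; have [s1 h1] := has_sum_restr (fun l : int => l <= -1) hf.
have [s2 h2] := has_sum_restr (fun l : int => 0 <= l) hf.
exists s1, s2; split; [exact: has_sum_le|exact: has_sum_ge|].
apply: has_sum_uniq hf _; apply: eq_has_sum (has_sumD h1 h2) => l /=.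
by case: (leP 0 l) => hl; case: (leP l (-1)) => hl'; rewrite ?add0r ?addr0 //; lia.
Qed.

Lemma sum_Z_uniq (f : int -> R[i]) s1 s2 : sum_Z f s1 -> sum_Z f s2 -> s1 = s2.
Proof.
move=> [a1 [b1 [ha1 hb1 ->]]] [a2 [b2 [ha2 hb2 ->]]].
by congr (_ + _); [exact: (cvg_unique _ ha1 ha2) | exact: (cvg_unique _ hb1 hb2)].
Qed.

End Series.

(** * The complex exponential and the functions I *)

Section Exponential.
Context {R : realType}.
Implicit Types (x y z t theta : R) (l : int).

Lemma has_sum_expR x : has_sum (fun k : nat => x ^+ k / k`!%:R) (expR x).
Proof.
apply: has_sum_limn; rewrite (_ : (fun n => _) = exp_coeff `|x|).
  exact: is_cvg_series_exp_coeff.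
by apply/funext => n; rewrite normrM normfV normrX normr_nat.
Qed.

Definition sinh t : R := (expR t - expR (- t)) / 2.

(** The exponential of [x + i y]. *)
Definition cexp x y : R[i] := (expR x)%:C * expi y.

Lemma expiD x y : expi (x + y) = expi x * expi y.
Proof.
by rewrite /expi cosD sinD; apply/eqP; rewrite eq_complex /= eqxx /= addrC mulrC
  [X in _ + X]mulrC eqxx.
Qed.

Lemma expi0 : expi 0 = 1 :> R[i].
Proof. by rewrite /expi cos0 sin0. Qed.

Lemma cexpD x1 x2 y1 y2 : cexp (x1 + x2) (y1 + y2) = cexp x1 y1 * cexp x2 y2.
Proof. by rewrite /cexp expRD expiD rmorphM /=; ring. Qed.

Lemma cexp0 : cexp 0 0 = 1.
Proof. by rewrite /cexp expR0 expi0 mulr1. Qed.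

Lemma norm_expi t : `|expi t| = 1.
Proof. by rewrite normc_def /= cos2Dsin2 sqrtr1. Qed.

(** The powers of [i y] distribute the exponential series over the cosine and
    the sine series. *)
Lemma has_sum_expi y :
  has_sum (fun k : nat => (0 +i* y) ^+ k / (k`!%:R)%:C) (expi y).
Proof.
have E k : (0 +i* y) ^+ k / (k`!%:R)%:C = cos_coeff y k +i* sin_coeff y k.
  have -> : (0 +i* y) ^+ k =
      ((~~ odd k)%:R * (-1) ^ k./2 * y ^+ k) +i*
      ((odd k)%:R * (-1) ^+ k.-1./2 * y ^+ k).
    rewrite -exprnP.
    elim: k => [|k IH]; first by rewrite !expr0 /= !mul1r mul0r mul0r.
    rewrite exprSr IH; case: k {IH} => [|k]; first by apply: complex_eq => /=; ring.
    rewrite /= negbK uphalf_half.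
    by case: (odd k); apply: complex_eq; rewrite /= ?add1n ?add0n !exprS; ring.
  rewrite -fmorphV /=; apply/eqP; rewrite eq_complex /= !mulr0 subr0 add0r.
  by rewrite !eqxx.
rewrite (funext E).
apply: has_sum_complex => /=; rewrite unlock; apply: has_sum_limn.
- have := is_cvg_series_exp_coeff `|y|; apply: series_le_cvg => n //.
    by rewrite /= divr_ge0.
  rewrite /exp_coeff /cos_coeff /= !normrM normfV !normr_nat !normrX.
  rewrite normrN1 expr1n mulr1.
  by case: odd; [rewrite !mul0r | rewrite mul1r].
- have := is_cvg_series_exp_coeff `|y|; apply: series_le_cvg => n //.
    by rewrite /= divr_ge0.
  rewrite /exp_coeff /sin_coeff /= !normrM normfV !normr_nat !normrX.
  rewrite normrN1 expr1n mulr1.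
  by case: odd; [rewrite mul1r | rewrite !mul0r].
Qed.

(** The product of the series of [exp x] and [exp (i y)], collected by total
    degree with the binomial formula. *)
Lemma has_sum_cexp x y :
  has_sum (fun k : nat => (x +i* y) ^+ k / (k`!%:R)%:C) (cexp x y).
Proof.
have hx := has_sum_real_complex (has_sum_expR x).
have hp := has_sum_prod hx (has_sum_expi y).
apply: (@has_sum_fibre _ _ _ (fun p : nat * nat => (p.1 + p.2)%N) _ _ _ hp).
move=> n; pose A := [seq ((n - i)%N, i) | i <- index_iota 0 n.+1].
have uA : uniq A.
  by rewrite map_inj_uniq ?iota_uniq // => i j [].
have := @has_sum_fin _ _ (fun p : nat * nat => if (p.1 + p.2 == n)%N then
  (x ^+ p.1 / (p.1)`!%:R)%:C * ((0 +i* y) ^+ p.2 / ((p.2)`!%:R)%:C) else 0)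
  A uA.
have -> : \sum_(i <- A) (if (i.1 + i.2 == n)%N then
  (x ^+ i.1 / (i.1)`!%:R)%:C * ((0 +i* y) ^+ i.2 / ((i.2)`!%:R)%:C) else 0) =
  (x +i* y) ^+ n / (n`!%:R)%:C.
  have -> : x +i* y = x%:C + (0 +i* y) :> R[i].
    by apply/eqP; rewrite eq_complex /= addr0 add0r !eqxx.
  rewrite exprDn big_map big_mkord mulr_suml; apply: eq_bigr => i _ /=.
  have iN : (i <= n)%N by rewrite -ltnS.
  rewrite subnK // eqxx.
  rewrite -(bin_fact iN) !natrM -mulr_natr !rmorphM /= fmorphV rmorphXn /=.
  rewrite rmorph_nat.
  field.
  by rewrite !pnatr_eq0 -!lt0n !fact_gt0 bin_gt0.
apply => -[a b]; case: eqP => //= abn.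
case/mapP; exists b; last by rewrite -abn addnK.
by rewrite mem_index_iota /= ltnS -abn leq_addl.
Qed.

Lemma has_sum_besselI l z :
  has_sum (fun k : nat => (z / 2) ^+ (2 * k + `|l|)%N
    / (k`!%:R * (k + `|l|)`!%:R)) (besselI l z).
Proof.
apply: has_sum_limn.
have [|s hs] := @sum_bounded_has_sum R _ (fun k : nat =>
  `|(z / 2) ^+ (2 * k + `|l|)%N / (k`!%:R * (k + `|l|)`!%:R)|).
  have := has_sum_bounded (has_sumZ ((z / 2) ^+ `|l|)
    (has_sum_expR ((z / 2) ^+ 2))).
  apply: sum_bounded_le => k; rewrite exprD exprM normr_id.
  have -> : (z / 2) ^+ 2 ^+ k * (z / 2) ^+ `|l| / (k`!%:R * (k + `|l|)`!%:R) =
      (z / 2) ^+ `|l| * ((z / 2) ^+ 2 ^+ k / k`!%:R) / (k + `|l|)`!%:R.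
    by field; rewrite !pnatr_eq0 -!lt0n !fact_gt0.
  rewrite normrM normfV normr_nat ler_piMr //.
  by rewrite invf_le1 ?ltr0n ?fact_gt0 // ler1n fact_gt0.
by have /cvgP := has_sum_series hs.
Qed.

Lemma besselI_ge0 l z : 0 <= z -> 0 <= besselI l z.
Proof.
move=> z0; have := has_sum_ge0 _ (has_sum_besselI l z) (erefl : uniq [::]).
rewrite big_nil; apply => k.
by rewrite divr_ge0 ?mulr_ge0 ?ler0n // exprn_ge0 // divr_ge0.
Qed.

Lemma besselI_gt0 l z : 0 < z -> 0 < besselI l z.
Proof.
move=> z0; have := has_sum_ge0 _ (has_sum_besselI l z) (erefl : uniq [:: 0%N]).
rewrite big_seq1 => h; apply: lt_le_trans (h _) => [|k]; last first.
  by rewrite divr_ge0 ?mulr_ge0 ?ler0n // exprn_ge0 // divr_ge0 // ltW.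
by rewrite divr_gt0 ?mulr_gt0 ?ltr0n ?fact_gt0 // exprn_gt0 // divr_gt0.
Qed.

Lemma cexp_mulrz (n : nat) x y : cexp (n%:R * x) (n%:R * y) = cexp x y ^+ n.
Proof.
elim: n => [|n IH]; first by rewrite !mul0r cexp0 expr0.
by rewrite exprS -IH -cexpD -natr1; congr cexp; ring.
Qed.

(** The Laurent expansion of [exp (z/2 (s + 1/s))] at [s = exp (t + i theta)]:
    the products of the terms of two exponential series are collected by
    the exponent of [s]. *)
Lemma has_sum_generating z t theta :
  has_sum (fun l : int => (besselI l z)%:C * cexp (l%:~R * t) (l%:~R * theta))
    (cexp (z * cosh t * cos theta) (z * sinh t * sin theta)).
Proof.
have w (e t1 th1 : R) : (e%:C * cexp t1 th1) =
    (e * expR t1 * cos th1) +i* (e * expR t1 * sin th1).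
  by rewrite /cexp; apply: complex_eq => /=; ring.
have hu := has_sum_cexp (z / 2 * expR t * cos theta)
  (z / 2 * expR t * sin theta).
have hv := has_sum_cexp (z / 2 * expR (- t) * cos (- theta))
  (z / 2 * expR (- t) * sin (- theta)).
have := has_sum_prod hu hv.
rewrite -cexpD -!w cosN sinN.
have -> : z / 2 * expR t * cos theta + z / 2 * expR (- t) * cos theta =
  z * cosh t * cos theta by rewrite /cosh; field.
have -> : z / 2 * expR t * sin theta + z / 2 * expR (- t) * - sin theta =
  z * sinh t * sin theta by rewrite /sinh; field.
move=> hp.
apply: (@has_sum_fibre _ _ _ (fun p : nat * nat => p.1%:Z - p.2%:Z) _ _ _ hp).
move=> l.
(* The pairs of exponents with difference l, indexed by their minimum. *)
pose e (n : nat) := ((n + `|Num.max l 0|)%N, (n + `|Num.max (- l) 0|)%N).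
apply/(@has_sum_reindex _ _ _ e
  (fun p => if p.1%:Z - p.2%:Z == l then Some (minn p.1 p.2) else None)).
- by move=> n; rewrite /e /=; case: eqP => [_|]; [congr Some; lia | lia].
- by move=> p; case: eqP.
- by move=> [a b] n /=; case: eqP => // ab [<-]; rewrite /e; congr pair; lia.
have := has_sumZ (cexp (l%:~R * t) (l%:~R * theta))
  (has_sum_real_complex (has_sum_besselI l z)).
rewrite [X in has_sum _ X -> _]mulrC; apply: eq_has_sum => n; rewrite /e /=.
case: eqP => [_|]; last by lia.
have ww : cexp t theta * cexp (- t) (- theta) = 1.
  by rewrite -cexpD !subrr cexp0.
have term (u v : R[i]) (m : nat) : u * v = 1 ->
    u ^+ m * ((z / 2) ^+ (2 * n + m) / (n`!%:R * (n + m)`!%:R))%:C =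
    ((z / 2)%:C * u) ^+ (n + m) / ((n + m)`!%:R)%:C *
    (((z / 2)%:C * v) ^+ n / (n`!%:R)%:C).
  move=> uv; have uvn : u ^+ n * v ^+ n = 1 by rewrite -exprMn uv expr1n.
  move: (z / 2) => q.
  rewrite rmorphM fmorphV !rmorphM rmorphXn /= !exprMn mul2n -addnn !exprD invfM.
  by rewrite -[LHS]mulr1 -uvn; ring.
case: l @e => m e.
  have -> : absz (Num.max (Posz m) 0) = m by lia.
  have -> : absz (Num.max (- Posz m) 0) = 0%N by lia.
  rewrite addn0 -pmulrn cexp_mulrz; exact: term.
have -> : absz (Num.max (Negz m) 0) = 0%N by lia.
have -> : absz (Num.max (- Negz m) 0) = m.+1 by lia.
have -> : `|Negz m|%N = m.+1 by lia.
have -> (x : R) : (Negz m)%:~R * x = m.+1%:R * (- x).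
  by rewrite NegzE mulrNz mulrN mulNr -pmulrn.
have -> (x : R) : (Negz m)%:~R * x = m.+1%:R * (- x).
  by rewrite NegzE mulrNz mulrN mulNr -pmulrn.
rewrite addn0 cexp_mulrz [RHS]mulrC; apply: term; by rewrite mulrC.
Qed.
End Exponential.

(** * Derivation rules *)

Section Derivatives.
Context {R : realType}.
Implicit Types (f g : R -> R) (x a b c : R).

(** A constant in place of the type class, so that a chain of rules computes the
    derivative and no instance resolution interferes. *)
Definition derive_at f x a : Prop := is_derive x 1 f a.

Lemma der_eq f x a b : derive_at f x a -> a = b -> derive_at f x b.
Proof. by move=> df <-. Qed.

Lemma der_cst c x : derive_at (fun _ : R => c) x 0.
Proof. exact: is_derive_cst. Qed.

Lemma der_id x : derive_at (fun t : R => t) x 1.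
Proof. exact: is_derive_id. Qed.

Lemma derD f g x a b : derive_at f x a -> derive_at g x b ->
  derive_at (fun t => f t + g t) x (a + b).
Proof. by move=> hf hg; exact: is_deriveD. Qed.

Lemma derN f x a : derive_at f x a -> derive_at (fun t => - f t) x (- a).
Proof. by move=> hf; exact: is_deriveN. Qed.

Lemma derM f g x a b : derive_at f x a -> derive_at g x b ->
  derive_at (fun t => f t * g t) x (f x * b + g x * a).
Proof. by move=> hf hg; exact: is_deriveM. Qed.

Lemma derX f n x a : derive_at f x a ->
  derive_at (fun t => f t ^+ n) x (n%:R * f x ^+ n.-1 * a).
Proof.
move=> hf; elim: n => [|n IH].
  by rewrite mulr0n !mul0r; exact: is_derive_cst.
have -> : (fun t => f t ^+ n.+1) = (fun t => f t * f t ^+ n).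
  by apply/funext => t; rewrite exprS.
apply: der_eq; first exact: derM hf IH.
by case: n {IH} => [|n] /=; rewrite ?exprS; ring.
Qed.

Lemma der_comp (h : R -> R) f x a b : derive_at f x a ->
  derive_at h (f x) b -> derive_at (fun t => h (f t)) x (b * a).
Proof. by move=> hf hh; exact: is_derive1_comp. Qed.

Lemma der_expR f x a : derive_at f x a ->
  derive_at (fun t => expR (f t)) x (expR (f x) * a).
Proof. by move=> hf; apply: der_comp hf _; exact: is_derive_expR. Qed.

Lemma der_cos f x a : derive_at f x a ->
  derive_at (fun t => cos (f t)) x (- sin (f x) * a).
Proof. by move=> hf; apply: der_comp hf _; exact: is_derive_cos. Qed.

Lemma der_sin f x a : derive_at f x a ->
  derive_at (fun t => sin (f t)) x (cos (f x) * a).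
Proof. by move=> hf; apply: der_comp hf _; exact: is_derive_sin. Qed.

Lemma der_cosh f x a : derive_at f x a ->
  derive_at (fun t => cosh (f t)) x (sinh (f x) * a).
Proof.
move=> hf; apply: der_eq.
  apply: (derM (b := 0)); last exact: der_cst.
  by apply: derD; apply: der_expR; [|apply: derN]; exact: hf.
by rewrite /sinh; field.
Qed.

Lemma der_sinh f x a : derive_at f x a ->
  derive_at (fun t => sinh (f t)) x (cosh (f x) * a).
Proof.
move=> hf; apply: der_eq.
  apply: (derM (b := 0)); last exact: der_cst.
  by apply: derD; [|apply: derN]; apply: der_expR; [|apply: derN]; exact: hf.
by rewrite /cosh; field.
Qed.

Lemma derive_at_derivable f x a : derive_at f x a -> derivable f x 1.
Proof. by case. Qed.

Lemma der_continuous f : (forall x, exists a, derive_at f x a) ->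
  continuous f.
Proof.
move=> df x; have [a [da _]] := df x.
by apply: differentiable_continuous; exact/derivable1_diffP.
Qed.

End Derivatives.

Ltac der := repeat first
  [ exact: der_id | exact: der_cst | apply: der_cosh | apply: der_sinh
  | apply: der_expR | apply: der_cos | apply: der_sin
  | apply: derD | apply: derN | apply: derX | apply: derM ].

(** * Integrals over a half line *)

Section HalfLine.
Context {R : realType}.
Notation mu := (@lebesgue_measure R).
Notation D := (`[(0 : R), +oo[%classic : set R).
Implicit Types (f g : R -> R) (t c z nu : R).

Lemma half_lineP t : D t <-> 0 <= t.
Proof. by rewrite /= in_itv /= andbT. Qed.

(** The common domination condition: stable under sums, and strong enough for
    integrability on the half line and for a zero limit at infinity. *)
Definition exp_decay f : Prop :=
  exists C : R, forall t, 0 <= t -> `|f t| <= C * expR (- t).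

Lemma cosh_ge0 t : 0 <= cosh t.
Proof. by rewrite divr_ge0 // addr_ge0 // expR_ge0. Qed.

Lemma cosh_ge1 t : 1 <= cosh t.
Proof.
have E : expR t * expR (- t) = 1 by rewrite expRxMexpNx_1.
have := expR_gt0 t; have := expR_gt0 (- t); rewrite /cosh => h1 h2.
have : 0 <= (expR t - expR (- t)) ^+ 2 by exact: sqr_ge0.
rewrite ler_pdivlMr //; nra.
Qed.

Lemma normr_sinh_le t : `|sinh t| <= cosh t.
Proof.
have h1 := expR_gt0 t; have h2 := expR_gt0 (- t).
by rewrite /sinh /cosh ler_norml; apply/andP; split; lra.
Qed.

Lemma cosh_le_expR t : cosh t <= expR `|t|.
Proof.
have h : forall s : R, expR s <= expR `|s| by move=> s; rewrite ler_expR ler_norm.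
by have := h t; have := h (- t); rewrite normrN /cosh; lra.
Qed.

Lemma coshN t : cosh (- t) = cosh t.
Proof. by rewrite /cosh opprK addrC. Qed.

Lemma sinhN t : sinh (- t) = - sinh t.
Proof. by rewrite /sinh opprK; field. Qed.

Lemma sinh0 : sinh 0 = 0 :> R.
Proof. by rewrite /sinh oppr0 subrr mul0r. Qed.

Lemma exp_decay_le f g : (forall t, 0 <= t -> `|f t| <= `|g t|) ->
  exp_decay g -> exp_decay f.
Proof. by move=> fg [C hC]; exists C => t t0; apply: le_trans (fg t t0) (hC t t0). Qed.

Lemma exp_decayZ c f : exp_decay f -> exp_decay (fun t => c * f t).
Proof.
move=> [C hC]; exists (`|c| * C) => t t0; rewrite normrM -mulrA.
by rewrite ler_wpM2l // hC.
Qed.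

Lemma exp_decayD f g : exp_decay f -> exp_decay g ->
  exp_decay (fun t => f t + g t).
Proof.
move=> [C hC] [C' hC']; exists (C + C') => t t0; rewrite mulrDl.
by apply: le_trans (ler_normD _ _) _; apply: lerD; [exact: hC|exact: hC'].
Qed.

(** [z cosh t >= z/2 exp t], and the convex function [z/2 exp t] lies above a
    tangent line of any prescribed slope. *)
Lemma exp_decay_cosh nu z : 0 < z ->
  exp_decay (fun t => expR (- (z * cosh t)) * expR (nu * t)).
Proof.
move=> z0; pose N := `|nu| + 1.
have N0 : 0 < N by rewrite ltr_wpDl.
have [L hL] : exists L, z / 2 * expR L = N.
  (* The slope of z/2 exp t at L is N. *)
  exists (ln (N / (z / 2))); rewrite lnK ?posrE ?divr_gt0 // mulrC divfK //.
  by rewrite gt_eqF // divr_gt0.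
exists (expR (N * (L - 1))) => t t0.
rewrite ger0_norm; last by rewrite mulr_ge0 // expR_ge0.
rewrite -!expRD ler_expR.
have h1 : z / 2 * expR t = N * expR (t - L).
  by rewrite -hL expRB; field; rewrite gt_eqF // expR_gt0.
have h2 := expR_ge1Dx (t - L).
have h3 : z / 2 * expR t <= z * cosh t.
  have := expR_ge0 (- t); rewrite /cosh; nra.
have h4 : nu * t <= `|nu| * t by rewrite ler_wpM2r // ler_norm.
have h5 : N * (1 + (t - L)) <= N * expR (t - L) by rewrite ler_wpM2l // ltW.
rewrite /N in h1 h5 *; lra.
Qed.

Lemma continuous_expRN : continuous (fun t : R => expR (- t)).
Proof. by apply: der_continuous => x; eexists; der. Qed.

Lemma integral_expRN : (\int[mu]_(t in D) (expR (- t))%:E = 1%:E)%E.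
Proof.
rewrite (@ge0_continuous_FTC2y _ _ (fun t => - expR (- t)) 0 0).
- by rewrite sub0e oppr0 expR0 EFinN oppeK.
- by move=> x _; rewrite expR_ge0.
- exact/continuous_subspaceT/continuous_expRN.
- by rewrite -oppr0; apply: cvgN; exact: cvgr_expR.
- by move=> x _; apply: derive_at_derivable; der.
- apply: cvg_at_right_filter; apply: (@der_continuous _ (fun t => - expR (- t))).
  by move=> x; eexists; der.
move=> x _; rewrite derive1E; apply: derive_val.
apply: (der_eq (a := _)); [by der | by rewrite mulrN1 opprK].
Qed.

Lemma integrable_decay f : continuous f -> exp_decay f ->
  mu.-integrable D (EFin \o f).
Proof.
move=> cf [C hC].
have mf : measurable_fun D f.
  by apply: measurable_funTS; exact: continuous_measurable_fun.
have ie : mu.-integrable D (EFin \o (fun t => expR (- t))).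
  apply/integrableP; split.
    apply/measurable_EFinP; apply: measurable_funTS.
    apply: continuous_measurable_fun; exact: continuous_expRN.
  under eq_integral do rewrite /= ger0_norm ?expR_ge0 //.
  by rewrite integral_expRN ltry.
apply: (@le_integrable _ _ _ mu D _ _ (fun t => (C * expR (- t))%:E)) => //.
- exact/measurable_EFinP.
- move=> t /half_lineP t0; rewrite /= lee_fin.
  by apply: le_trans (hC t t0) _; exact: ler_norm.
- exact: (integrableZl _ C ie).
Qed.

Lemma Rintegral_expRN : \int[mu]_(t in D) expR (- t) = 1 :> R.
Proof. by rewrite /Rintegral integral_expRN. Qed.

Lemma cvg_decay f : exp_decay f -> f x @[x --> +oo] --> 0.
Proof.
move=> [C hC]; apply: norm_cvg0.
apply: (@squeeze_cvgr _ _ _ _ (cst 0) (fun t => C * expR (- t))).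
- have h : \forall t \near +oo, 0 <= (t : R) by exact: nbhs_pinfty_ge.
  by apply: filterS h => t t0; rewrite /= normr_ge0 hC.
- exact: cvg_cst.
- rewrite -[X in _ --> X](mulr0 C); apply: cvgMr; exact: cvgr_expR.
Qed.

(** The fundamental theorem for nonnegative integrands applies after adding the
    dominating exponential, whose integral is known. *)
Lemma Rintegral_half_line_derive f g :
  (forall t, derive_at f t (g t)) -> continuous g ->
  exp_decay f -> exp_decay g -> \int[mu]_(t in D) g t = - f 0.
Proof.
move=> dfg cg df dg; have [C hC] := dg.
have ie : exp_decay (fun t => C * expR (- t)).
  by apply: exp_decayZ; exists 1 => t _; rewrite mul1r ger0_norm // expR_ge0.
have ce : continuous (fun t => C * expR (- t)).
  by apply: der_continuous => x; eexists; der.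
have H : \int[mu]_(t in D) (g t + C * expR (- t)) = 0 - (f 0 - C * expR (- 0)).
  apply: (@Rintegral_ge0_continuous_FTC2y _ _ (fun t => f t - C * expR (- t)))
    => //.
  - by move=> t t0; have := hC t t0; rewrite ler_norml => /andP[]; lra.
  - by apply: continuous_subspaceT => x; apply: cvgD; [exact: cg|exact: ce].
  - by rewrite -[0]subr0; apply: cvgB; exact: cvg_decay.
  - by move=> x _; apply: derive_at_derivable; apply: derD (dfg x) _; der.
  - apply: cvg_at_right_filter.
    apply: (@der_continuous _ (fun t => f t - C * expR (- t))) => x.
    by eexists; apply: derD (dfg x) _; der.
  - move=> x _; rewrite derive1E; apply: derive_val.
    apply: (der_eq (a := _)); first by apply: derD (dfg x) _; der.
    by rewrite /=; ring.
move: H; rewrite RintegralD //; [|exact: integrable_decay..].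
rewrite RintegralZl //; last first.
  apply: integrable_decay; first exact: continuous_expRN.
  by exists 1 => t _; rewrite mul1r ger0_norm // expR_ge0.
rewrite Rintegral_expRN oppr0 expR0; lra.
Qed.

(** [G] dominates the derivative uniformly near the point: this is the
    domination needed for the difference quotients. *)
Lemma derive_at_Rintegral (f df : R -> R -> R) (G : R -> R) a u v :
  u < a -> a < v ->
  (forall x t, u < x -> x < v -> derive_at (f ^~ t) x (df x t)) ->
  (forall x, u < x -> x < v -> continuous (f x)) ->
  (forall x, u < x -> x < v -> exp_decay (f x)) ->
  continuous G -> exp_decay G -> (forall t, 0 <= G t) ->
  (forall x t, u < x -> x < v -> 0 <= t -> `|df x t| <= G t) ->
  derive_at (fun x => \int[mu]_(t in D) f x t) a (\int[mu]_(t in D) df a t).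
Proof.
move=> ua av dfx cf ef cG eG G0 Gub.
have Ia : `]u, v[%classic a by rewrite /= in_itv /= ua av.
have d1f x t : u < x -> x < v -> partial1of2 f x t = df x t.
  by move=> ux xv; rewrite partial1of2E; apply: derive_val; exact: dfx.
have intf x : `]u, v[%classic x -> mu.-integrable D (EFin \o f x).
  rewrite /= in_itv /= => /andP[ux xv].
  by apply: integrable_decay; [exact: cf | exact: ef].
have derf x t : `]u, v[%classic x -> D t -> derivable (f ^~ t) x 1.
  rewrite /= in_itv /= => /andP[ux xv] _.
  exact: derive_at_derivable (dfx x t ux xv).
have Gub' x t : `]u, v[%classic x -> D t -> `|partial1of2 f x t| <= G t.
  rewrite /= in_itv /= => /andP[ux xv] /half_lineP t0.
  by rewrite d1f //; exact: Gub.
have iG := integrable_decay cG eG.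
have F1 : derivable (fun x => \int[mu]_(t in D) f x t) a 1.
  exact: (@derivable_under_integral _ _ _ mu f D _ a u v Ia intf derf G G0 iG).
have F2 : derive1 (fun x => \int[mu]_(t in D) f x t) a =
    \int[mu]_(t in D) (partial1of2 f ^~ t) a.
  exact: (@differentiation_under_integral _ _ _ mu f D _ a u v Ia intf derf
    G G0 iG).
have -> : \int[mu]_(t in D) df a t =
    derive1 (fun x => \int[mu]_(t in D) f x t) a.
  by rewrite F2; apply: eq_Rintegral => t _; rewrite d1f.
by rewrite derive1E /derive_at; apply/derivableP.
Qed.

End HalfLine.

(** * The functions K *)

Section BesselK.
Context {R : realType}.
Notation mu := (@lebesgue_measure R).
Notation D := (`[(0 : R), +oo[%classic : set R).
Implicit Types (t z nu : R) (n m : int).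

Definition besselK_fun n z t : R := expR (- (z * cosh t)) * cosh (n%:~R * t).

Lemma cosh_le_expR0 t : 0 <= t -> cosh t <= expR t.
Proof. by move=> t0; have := cosh_le_expR t; rewrite ger0_norm. Qed.

Lemma besselK_fun_ge0 n z t : 0 <= besselK_fun n z t.
Proof. by rewrite mulr_ge0 // ?expR_ge0 // cosh_ge0. Qed.

Lemma besselK_fun_decay n z : 0 < z -> exp_decay (besselK_fun n z).
Proof.
move=> z0; apply: exp_decay_le (exp_decay_cosh `|n%:~R| z0) => t t0.
rewrite ger0_norm ?besselK_fun_ge0 // ger0_norm; last first.
  by rewrite mulr_ge0 // expR_ge0.
rewrite ler_wpM2l ?expR_ge0 //; apply: le_trans (cosh_le_expR _) _.
by rewrite normrM (ger0_norm t0).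
Qed.

Lemma besselK_fun_continuous n z : continuous (besselK_fun n z).
Proof. by apply: der_continuous => t; rewrite /besselK_fun; eexists; der. Qed.

Lemma besselK_fun_integrable n z : 0 < z ->
  mu.-integrable D (EFin \o besselK_fun n z).
Proof.
move=> z0; apply: integrable_decay; first exact: besselK_fun_continuous.
exact: besselK_fun_decay.
Qed.

Lemma besselKN n z : besselK (- n) z = besselK n z.
Proof.
rewrite /besselK; apply: eq_Rintegral => t _.
by rewrite mulrNz mulNr coshN.
Qed.

Lemma besselK_abs n z : besselK `|n|%N z = besselK n z.
Proof. by case: n => m; rewrite ?NegzE ?besselKN // abszN. Qed.

Lemma besselK_ge0 n z : 0 <= besselK n z.
Proof. by apply: Rintegral_ge0 => t _; exact: besselK_fun_ge0. Qed.

(** [z exp t exp (- z exp t)] has an elementary integral and is at most a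
    multiple of the integrand of [K]. *)
Lemma besselK_gt0 n z : 0 < z -> 0 < besselK n z.
Proof.
move=> z0.
have dE : exp_decay (fun t => z * expR t * expR (- (z * expR t))).
  apply: exp_decay_le (exp_decayZ z (exp_decay_cosh 1 z0)) => t t0.
  rewrite !ger0_norm ?mulr_ge0 ?expR_ge0 ?(ltW z0) // mul1r.
  rewrite -mulrA ler_wpM2l ?(ltW z0) // mulrC ler_wpM2r ?expR_ge0 // ler_expR lerN2.
  by rewrite ler_wpM2l ?(ltW z0) // cosh_le_expR0.
have E : \int[mu]_(t in D) (z * expR t * expR (- (z * expR t))) = expR (- z).
  have := @Rintegral_half_line_derive R (fun t => - expR (- (z * expR t)))
    (fun t => z * expR t * expR (- (z * expR t))).
  rewrite expR0 mulr1 opprK; apply.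
  - by move=> t; apply: der_eq; [der | rewrite /=; ring].
  - by apply: der_continuous => t; eexists; der.
  - apply: exp_decay_le (exp_decay_cosh 0 z0) => t t0.
    rewrite normrN mul0r expR0 mulr1 !ger0_norm ?expR_ge0 // ler_expR lerN2.
    by rewrite ler_wpM2l ?(ltW z0) // cosh_le_expR0.
  - exact: dE.
rewrite -(pmulr_rgt0 _ (expR_gt0 (z / 2))); apply: lt_le_trans (expR_gt0 (- z)) _.
rewrite -E /besselK -RintegralZl //; last exact: besselK_fun_integrable.
apply: le_Rintegral => //.
- apply: integrable_decay; first by apply: der_continuous => t; eexists; der.
  exact: dE.
- apply: integrable_decay.
    by apply: der_continuous => t; eexists; der.
  exact/exp_decayZ/besselK_fun_decay.
move=> t /half_lineP t0.
have h (x : R) : 0 <= x -> x * expR (- x) <= expR (- (x / 2)).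
  move=> x0; have -> : - x = - (x / 2) + - (x / 4) + - (x / 4) by field.
  rewrite !expRD -mulrA mulrC -mulrA ler_piMr ?expR_ge0 //.
  rewrite !expRN -invfM ler_pdivrMl ?mulr_gt0 ?expR_gt0 // mulr1.
  have := expR_ge1Dx (x / 4); have := sqr_ge0 (1 - x / 4); nra.
apply: le_trans (h _ _) _; first by rewrite mulr_ge0 ?expR_ge0 // ltW.
rewrite /besselK_fun mulrA -expRD -[leLHS]mulr1 ler_pM ?expR_ge0 ?cosh_ge1 //.
rewrite ler_expR.
have : expR (- t) <= 1 by rewrite expR_le1 oppr_le0.
rewrite /cosh; nra.
Qed.

(** The integral of the derivative of [exp (- z cosh t) sinh (n t)] vanishes. *)
Lemma besselK_recurrence n z : 0 < z ->
  n%:~R * besselK n z = z / 2 * (besselK (n + 1) z - besselK (n - 1) z).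
Proof.
move=> z0.
have i m := @besselK_fun_integrable m z z0.
pose g t := n%:~R * besselK_fun n z t -
  z / 2 * (besselK_fun (n + 1) z t - besselK_fun (n - 1) z t).
have dg : exp_decay g.
  apply: exp_decayD; first exact/exp_decayZ/besselK_fun_decay.
  apply: (@exp_decay_le _ _ (fun t => (z / 2) *
    (besselK_fun (n + 1) z t + -1 * besselK_fun (n - 1) z t))).
    by move=> t _; rewrite normrN mulN1r.
  by apply/exp_decayZ/exp_decayD; [|apply: exp_decayZ];
    exact: besselK_fun_decay.
have : \int[mu]_(t in D) g t = 0.
  rewrite (@Rintegral_half_line_derive _
    (fun t => expR (- (z * cosh t)) * sinh (n%:~R * t))) //.
  - by rewrite mulr0 sinh0 mulr0 oppr0.
  - move=> t; apply: der_eq; first by der.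
    rewrite /g /besselK_fun intrD intrB !mulrDl /= mul1r mulN1r.
    rewrite /cosh /sinh !opprD !expRD opprK.
    have := expRxMexpNx_1 t; move: (expR t) (expR (- t)) => a b ab.
    by field.
  - by apply: der_continuous => t; rewrite /g /besselK_fun; eexists; der.
  - apply: exp_decay_le (@besselK_fun_decay n z z0) => t _.
    rewrite /besselK_fun normrM [leRHS]normrM; apply: ler_wpM2l => //.
    by rewrite [leRHS]ger0_norm ?cosh_ge0 // normr_sinh_le.
have -> : \int[mu]_(t in D) g t = n%:~R * besselK n z -
    z / 2 * (besselK (n + 1) z - besselK (n - 1) z).
  have iB : mu.-integrable D
      (EFin \o (fun t => besselK_fun (n + 1) z t - besselK_fun (n - 1) z t)).
    exact: (integrableB _ (i (n + 1)) (i (n - 1))).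
  rewrite RintegralB //; first last.
  - exact: (integrableZl _ (z / 2) iB).
  - exact: (integrableZl _ n%:~R (i n)).
  by rewrite !RintegralZl // RintegralB.
by move/subr0_eq.
Qed.

Lemma besselK_derive n z : 0 < z ->
  derive_at (besselK n) z (- ((besselK (n - 1) z + besselK (n + 1) z) / 2)).
Proof.
move=> z0.
pose G t := expR (- (z / 2 * cosh t)) * expR ((`|n%:~R| + 1) * t).
have z20 : 0 < z / 2 by rewrite divr_gt0.
have -> : - ((besselK (n - 1) z + besselK (n + 1) z) / 2) =
    \int[mu]_(t in D) (- cosh t * besselK_fun n z t).
  have i m := @besselK_fun_integrable m z z0.
  transitivity (- 2^-1 * (besselK (n - 1) z + besselK (n + 1) z)).
    by field.
  have -> : besselK (n - 1) z + besselK (n + 1) z = \int[mu]_(t in D)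
      (besselK_fun (n - 1) z t + besselK_fun (n + 1) z t).
    by rewrite RintegralD.
  have iD : mu.-integrable D
      (EFin \o (fun t => besselK_fun (n - 1) z t + besselK_fun (n + 1) z t)).
    exact: (integrableD _ (i (n - 1)) (i (n + 1))).
  rewrite -RintegralZl //.
  apply: eq_Rintegral => t _; rewrite /besselK_fun intrB intrD !mulrDl mulN1r mul1r.
  by rewrite /cosh !opprD !expRD opprK; field.
apply: (@derive_at_Rintegral _ (besselK_fun n)
  (fun x t => - cosh t * besselK_fun n x t) G _ (z / 2) (z + 1)).
- by lra.
- by lra.
- move=> x t _ _; apply: der_eq; rewrite /besselK_fun; [by der | rewrite /=; ring].
- by move=> x _ _; exact: besselK_fun_continuous.
- by move=> x zx _; apply: besselK_fun_decay; exact: lt_trans zx.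
- by apply: der_continuous => t; rewrite /G; eexists; der.
- exact: exp_decay_cosh.
- by move=> t; rewrite mulr_ge0 // expR_ge0.
move=> x t zx _ t0.
rewrite normrM normrN (ger0_norm (cosh_ge0 _)).
rewrite (ger0_norm (besselK_fun_ge0 _ _ _)) /G /besselK_fun mulrCA.
apply: ler_pM; rewrite ?mulr_ge0 ?expR_ge0 ?cosh_ge0 //.
  by rewrite ler_expR lerN2 ler_wpM2r ?cosh_ge0 // ltW.
rewrite addrC mulrDl mul1r expRD -[X in expR X](ger0_norm t0).
rewrite ler_pM ?cosh_ge0 ?cosh_le_expR //.
by apply: le_trans (cosh_le_expR _) _; rewrite normrM (ger0_norm t0).
Qed.

(** [cosh b - cosh a] is half of
    [(exp b - exp a) (1 - exp (- a) exp (- b))]. *)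
Lemma cosh_le (a b : R) : 0 <= a -> a <= b -> cosh a <= cosh b.
Proof.
move=> a0 ab; rewrite /cosh ler_pM2r //.
have h1 : expR a <= expR b by rewrite ler_expR.
have h2 : expR (- b) <= expR (- a) by rewrite ler_expR lerN2.
have E1 := expRxMexpNx_1 a; have E2 := expRxMexpNx_1 b.
have h3 : expR (- b) <= 1 by rewrite expR_le1 oppr_le0 (le_trans a0).
have h4 : expR (- a) <= 1 by rewrite expR_le1 oppr_le0.
have h5 : 1 <= expR a by rewrite -expR0 ler_expR.
have h6 := expR_gt0 (- a); have h7 := expR_gt0 (- b).
have : 0 <= (expR b - expR a) * (1 - expR (- a) * expR (- b)).
  by rewrite mulr_ge0 ?subr_ge0 // mulr_ile1 // ltW.
nra.
Qed.

Lemma besselK_leS (n : nat) z : 0 < z -> besselK n z <= besselK n.+1 z.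
Proof.
move=> z0; apply: le_Rintegral => //; try exact: besselK_fun_integrable.
move=> t /half_lineP t0; rewrite ler_wpM2l ?expR_ge0 // -!pmulrn cosh_le //.
  by rewrite mulr_ge0.
by rewrite ler_wpM2r // ler_nat.
Qed.

End BesselK.

(** * Moving the line of integration *)

Section Contour.
Context {R : realType}.
Notation mu := (@lebesgue_measure R).
Notation D := (`[(0 : R), +oo[%classic : set R).
Implicit Types (t z s x : R).

Lemma cst_of_derive0 (F : R -> R) (c x : R) :
  (forall y, `|y| < c -> derive_at F y 0) -> `|x| < c -> F x = F 0.
Proof.
move=> dF xc.
have cont (a b : R) : `|a| < c -> `|b| < c -> {within `[a, b], continuous F}.
  move=> ac bc; apply: derivable_within_continuous => y.
  rewrite in_itv /= => /andP[ay yb]; apply: derive_at_derivable (dF y _).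
  rewrite ltr_norml; move: ac bc; rewrite !ltr_norml => /andP[? ?] /andP[? ?].
  by apply/andP; split; lra.
have c0 : `|0 : R| < c by rewrite normr0; exact: le_lt_trans (normr_ge0 x) xc.
have mid (a b y : R) : `|a| < c -> `|b| < c -> y \in `]a, b[ ->
    is_derive y 1 F ((fun=> 0) y).
  move=> ac bc; rewrite in_itv /= => /andP[ay yb]; apply: dF.
  rewrite ltr_norml; move: ac bc; rewrite !ltr_norml => /andP[? ?] /andP[? ?].
  by apply/andP; split; lra.
have [x0|x0|->//] := ltgtP x 0.
- have [y _ /eqP] := MVT x0 (fun y => mid _ _ y xc c0) (cont _ _ xc c0).
  by rewrite mul0r subr_eq0 => /eqP ->.
- have [y _ /eqP] := MVT x0 (fun y => mid _ _ y c0 xc) (cont _ _ c0 xc).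
  by rewrite mul0r subr_eq0 => /eqP ->.
Qed.

Variables (r phi : R) (m : int).
Hypothesis r0 : 0 < r.
Let X s x t := - (s * m%:~R * t) - r * cosh t * cos x.
Let Y s x t := m%:~R * x + s * r * sinh t * sin x + phi.
Let W s x t := expR (X s x t) * cos (Y s x t).
Let B s x t := expR (X s x t) * sin (Y s x t).
Let dW s x t := expR (X s x t) * (r * cosh t * sin x * cos (Y s x t)
  - (m%:~R + s * r * sinh t * cos x) * sin (Y s x t)).

Lemma der_W s x t : derive_at (fun x => W s x t) x (dW s x t).
Proof.
apply: der_eq; first by rewrite /W /X /Y; der.
by rewrite /dW /X /Y /=; ring.
Qed.

(** The Cauchy-Riemann equation for [exp (- m w - r cosh w)] at [w = s t + i x],
    up to a constant phase, with a sign [s]. *)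
Lemma der_B s x t : s ^+ 2 = 1 -> derive_at (B s x) t (s * dW s x t).
Proof.
move=> s2; apply: der_eq; first by rewrite /B /X /Y; der.
by rewrite /dW /X /Y /=; ring: s2.
Qed.

Let E k t := expR (- (r * k * cosh t)) * expR (`|m%:~R| * t).

Lemma expX_le s x t k : `|s| = 1 -> 0 <= t -> k <= cos x ->
  expR (X s x t) <= E k t.
Proof.
move=> s1 t0 kx; rewrite /E -expRD ler_expR /X addrC; apply: lerD.
  by rewrite lerN2 mulrAC; apply: ler_wpM2l => //; rewrite mulr_ge0 ?cosh_ge0 // ltW.
by rewrite (le_trans (ler_norm _)) // normrN !normrM s1 mul1r (ger0_norm t0).
Qed.

Lemma W_le s x t k : `|s| = 1 -> 0 <= t -> k <= cos x -> `|W s x t| <= E k t.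
Proof.
move=> s1 t0 kx; apply: le_trans (expX_le s1 t0 kx).
by rewrite normrM ger0_norm ?expR_ge0 // ler_piMr ?expR_ge0 // cos_max.
Qed.

Lemma B_le s x t k : `|s| = 1 -> 0 <= t -> k <= cos x -> `|B s x t| <= E k t.
Proof.
move=> s1 t0 kx; apply: le_trans (expX_le s1 t0 kx).
by rewrite normrM ger0_norm ?expR_ge0 // ler_piMr ?expR_ge0 // sin_max.
Qed.

Let G k t := (r + `|m%:~R| + r) * (expR (- (r * k * cosh t)) *
  expR ((`|m%:~R| + 1) * t)).

Lemma dW_le s x t k : `|s| = 1 -> 0 <= t -> k <= cos x -> `|dW s x t| <= G k t.
Proof.
move=> s1 t0 kx; rewrite /dW normrM (ger0_norm (expR_ge0 _)).
have -> : G k t = E k t * ((r + `|m%:~R| + r) * expR t).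
  by rewrite /G /E [(_ + 1) * t]mulrDl mul1r expRD; ring.
apply: ler_pM => //; rewrite ?expR_ge0 ?expX_le //.
have et : 1 <= expR t by apply: le_trans (expR_ge1Dx t); lra.
have ct : `|cosh t| <= expR t.
  by rewrite ger0_norm ?cosh_ge0 // cosh_le_expR0.
have st : `|sinh t| <= expR t.
  by apply: le_trans (normr_sinh_le t) (cosh_le_expR0 t0).
have le1 (a b : R) : `|b| <= 1 -> `|a * b| <= `|a|.
  by move=> b1; rewrite normrM ler_piMr.
have -> : (r + `|m%:~R| + r) * expR t =
    r * expR t + (`|m%:~R| * expR t + r * expR t) by ring.
apply: le_trans (ler_normB _ _) _; apply: lerD.
  apply: le_trans (le1 _ _ (cos_max _)) _; apply: le_trans (le1 _ _ (sin_max _)) _.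
  by rewrite normrM (gtr0_norm r0) ler_wpM2l // ltW.
apply: le_trans (le1 _ _ (sin_max _)) _; apply: le_trans (ler_normD _ _) _.
apply: lerD; first by rewrite ler_peMr.
apply: le_trans (le1 _ _ (cos_max _)) _.
by rewrite normrM [`|s * r|]normrM s1 mul1r (gtr0_norm r0) ler_wpM2l // ltW.
Qed.

Lemma decay_E k : 0 < k -> exp_decay (E k).
Proof. by move=> k0; apply: exp_decay_cosh; rewrite mulr_gt0. Qed.

Lemma decay_G k : 0 < k -> exp_decay (G k).
Proof. by move=> k0; apply: exp_decayZ; apply: exp_decay_cosh; rewrite mulr_gt0. Qed.

Lemma decay_bound (f g : R -> R) : (forall t, 0 <= t -> `|f t| <= g t) ->
  exp_decay g -> exp_decay f.
Proof.
move=> fg; apply: exp_decay_le => t t0; apply: le_trans (fg t t0) _.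
exact: ler_norm.
Qed.

Let f x t := (W 1 x t + W (-1) x t) / 2.

Lemma cos_ge_cos (b x : R) : `|x| <= b -> b <= pi -> cos b <= cos x.
Proof.
move=> xb bpi; rewrite -(cos_norm x).
have b0 : 0 <= b by exact: le_trans xb.
have [->|xb'] := eqVneq `|x| b; first exact: lexx.
have {xb xb'}xb : `|x| < b by rewrite lt_neqAle xb' xb.
apply: ltW; rewrite (@ltr_cos R) // in_itv /= ?normr_ge0 ?b0 //=.
exact: le_trans (ltW xb) bpi.
Qed.

(** The line of integration can be moved to [t + i x] as long as [cos x > 0]:
    the derivative in [x] of the integral is the integral of a derivative in
    [t], whose boundary terms at [t = 0] cancel between the two half lines. *)
Lemma Rintegral_contour (alpha : R) : `|alpha| < pi / 2 ->
  \int[mu]_(t in D) f alpha t = besselK m r * cos phi.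
Proof.
move=> ha.
pose F x := \int[mu]_(t in D) f x t.
have -> : \int[mu]_(t in D) f alpha t = F 0.
  apply: (@cst_of_derive0 F (pi / 2)) => // a hb {alpha ha}.
  pose b := (`|a| + pi / 2) / 2.
  have pi0 := pi_gt0 R.
  have b0 : 0 < cos b.
    by apply: cos_gt0_pihalf; have := normr_ge0 a; rewrite /b; lra.
  have ab : `|a| < b by rewrite /b; lra.
  have cosb x : - b < x -> x < b -> cos b <= cos x.
    move=> xb1 xb2; apply: cos_ge_cos; last by rewrite /b; lra.
    by rewrite ler_norml; apply/andP; split; apply: ltW.
  have n1 : `|1 : R| = 1 by rewrite normr1.
  have nN1 : `|-1 : R| = 1 by rewrite normrN1.
  move: ab; rewrite ltr_norml => /andP[ab1 ab2].
  have -> : 0 = \int[mu]_(t in D) ((dW 1 a t + dW (-1) a t) / 2).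
    rewrite (@Rintegral_half_line_derive _ (fun t => (B 1 a t - B (-1) a t) / 2)).
    - by rewrite /B /X /Y sinh0 !mulr0 !mul0r subrr mul0r oppr0.
    - move=> t; apply: der_eq.
        apply: (derM (b := 0)); last exact: der_cst.
        by apply: derD; [|apply: derN]; apply: der_B; rewrite ?expr1n ?sqrrN ?expr1n.
      by rewrite /=; ring.
    - by apply: der_continuous => t; rewrite /dW /X /Y; eexists; der.
    - apply: (@decay_bound _ (E (cos b))); last exact: decay_E.
      move=> t t0; have h1 := B_le n1 t0 (cosb _ ab1 ab2).
      have h2 := B_le nN1 t0 (cosb _ ab1 ab2).
      rewrite normrM [`|2^-1|]ger0_norm // ler_pdivrMr //.
      by apply: le_trans (ler_normB _ _) _; lra.
    - apply: (@decay_bound _ (G (cos b))); last exact: decay_G.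
      move=> t t0; have h1 := dW_le n1 t0 (cosb _ ab1 ab2).
      have h2 := dW_le nN1 t0 (cosb _ ab1 ab2).
      rewrite normrM [`|2^-1|]ger0_norm // ler_pdivrMr //.
      by apply: le_trans (ler_normD _ _) _; lra.
  apply: (@derive_at_Rintegral _ f (fun x t => (dW 1 x t + dW (-1) x t) / 2)
    (G (cos b)) _ (- b) b) => //.
  - move=> x t _ _; apply: der_eq.
      apply: (derM (b := 0)); last exact: der_cst.
      by apply: derD; exact: der_W.
    by rewrite /=; ring.
  - by move=> x _ _; apply: der_continuous => t; rewrite /f /W /X /Y; eexists; der.
  - move=> x xb1 xb2; apply: (@decay_bound _ (E (cos b))); last exact: decay_E.
    move=> t t0; have h1 := W_le n1 t0 (cosb _ xb1 xb2).
    have h2 := W_le nN1 t0 (cosb _ xb1 xb2).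
    rewrite normrM [`|2^-1|]ger0_norm // ler_pdivrMr //.
    by apply: le_trans (ler_normD _ _) _; lra.
  - by apply: der_continuous => t; rewrite /G; eexists; der.
  - exact: decay_G.
  - by move=> t; rewrite !mulr_ge0 ?addr_ge0 ?expR_ge0 // ltW.
  move=> x t xb1 xb2 t0; have h1 := dW_le n1 t0 (cosb _ xb1 xb2).
  have h2 := dW_le nN1 t0 (cosb _ xb1 xb2).
  rewrite normrM [`|2^-1|]ger0_norm // ler_pdivrMr //.
  by apply: le_trans (ler_normD _ _) _; lra.
rewrite mulrC /besselK -RintegralZl //; last exact: besselK_fun_integrable.
apply: eq_Rintegral => t _; rewrite /f /W /X /Y /cosh sin0 cos0 !mulr0 !mulr1 !add0r.
by rewrite !mul1r !mulN1r !mulNr opprK !expRD; field.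
Qed.

End Contour.

(** * Graf's addition theorem *)

Section Exhaust.
Context {R : realType}.

Definition int_range (N : nat) : seq int :=
  [seq k%:Z - N%:Z | k <- iota 0 (2 * N)].

Lemma int_range_uniq N : uniq (int_range N).
Proof. by rewrite map_inj_uniq ?iota_uniq // => i j /addIr [->]. Qed.

Lemma has_sum_int_range (f : int -> R) s : has_sum f s ->
  (fun N => \sum_(l <- int_range N) f l) @ \oo --> s.
Proof.
move=> [_ hf]; apply/cvgrPdist_le => e e0; have [A hA] := hf _ e0.
near=> N; rewrite distrC; apply: hA; first exact: int_range_uniq.
have hN : (\max_(l <- A) `|l| < N)%N by near: N; exact: nbhs_infty_gt.
move=> l lA; have lN : (`|l| < N)%N.
  by apply: leq_ltn_trans hN; exact: (@leq_bigmax_seq _ A xpredT absz l).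
apply/mapP; exists (absz (l + N%:Z)%R); last by lia.
by rewrite mem_iota; lia.
Unshelve. all: by end_near. Qed.

End Exhaust.

Section Graf.
Context {R : realType}.
Notation mu := (@lebesgue_measure R).
Notation D := (`[(0 : R), +oo[%classic : set R).
Implicit Types (t z : R).

Lemma has_sum_generating_phase z t theta phi :
  has_sum (fun l : int => besselI l z * expR (l%:~R * t) *
    cos (l%:~R * theta + phi))
    (expR (z * cosh t * cos theta) * cos (z * sinh t * sin theta + phi)).
Proof.
have E (a b : R) : complex.Re (expi phi * cexp a b) = expR a * cos (b + phi).
  by rewrite /= cosD; ring.
rewrite -E.
apply: eq_has_sum (has_sum_Re (has_sumZ (expi phi)
  (has_sum_generating z t theta))) => l.
by rewrite mulrCA /= -[besselI l z * _ * _]mulrA -E /=; ring.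
Qed.

(** The generating function at [t] and at [- t], weighted by the two
    exponentials of which [cosh ((l - m) t)] consists. *)
Lemma has_sum_besselK_fun z0 z t theta phi (m : int) :
  has_sum (fun l : int => besselI l z * cos (l%:~R * theta + phi) *
      besselK_fun (l - m) z0 t)
    (expR (- (z0 * cosh t)) * expR (z * cosh t * cos theta) *
      ((expR (- (m%:~R * t)) * cos (z * sinh t * sin theta + phi) +
       expR (m%:~R * t) * cos (- (z * sinh t * sin theta) + phi)) / 2)).
Proof.
have h1 := has_sum_generating_phase z t theta phi.
have h2 := has_sum_generating_phase z (- t) theta phi.
pose c1 := expR (- (z0 * cosh t)) * expR (- (m%:~R * t)) / 2.
pose c2 := expR (- (z0 * cosh t)) * expR (m%:~R * t) / 2.
have := has_sumD (has_sumZ c1 h1) (has_sumZ c2 h2).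
rewrite coshN sinhN mulrN mulNr.
rewrite (_ : c1 * _ + c2 * _ = expR (- (z0 * cosh t)) *
  expR (z * cosh t * cos theta) *
  ((expR (- (m%:~R * t)) * cos (z * sinh t * sin theta + phi) +
  expR (m%:~R * t) * cos (- (z * sinh t * sin theta) + phi)) / 2)); last first.
  by rewrite /c1 /c2; field.
apply: eq_has_sum => l /=; rewrite /c1 /c2 /besselK_fun intrB mulrBl /cosh.
by rewrite !mulrN !opprB !expRD; field.
Qed.

Lemma Rintegral_sum (I : eqType) (s : seq I) (f : I -> R -> R) :
  (forall i, continuous (f i)) -> (forall i, exp_decay (f i)) ->
  [/\ continuous (fun t => \sum_(i <- s) f i t),
      exp_decay (fun t => \sum_(i <- s) f i t) &
      \int[mu]_(t in D) (\sum_(i <- s) f i t) =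
      \sum_(i <- s) \int[mu]_(t in D) f i t].
Proof.
move=> cf ef; elim: s => [|i s [IH1 IH2 IH3]].
  under eq_fun do rewrite big_nil.
  rewrite big_nil; split.
  - by move=> x; exact: cvg_cst.
  - by exists 0 => t _; rewrite normr0 mul0r.
  - by rewrite /Rintegral integral0.
have E : (fun t => \sum_(j <- i :: s) f j t) =
    (fun t => f i t + \sum_(j <- s) f j t).
  by apply/funext => t; rewrite big_cons.
rewrite E big_cons -IH3; split.
- by move=> x; apply: cvgD; [exact: cf|exact: IH1].
- exact: exp_decayD.
- by rewrite RintegralD //; exact: integrable_decay.
Qed.

(** Graf's addition theorem, as the real part of its product with a phase.
    Under the integral sign it is the generating function of [I]; the sum of
    the integrand is that of [K_m] at a complex shift of [t], which the
    contour lemma removes. All partial sums are dominated by the aligned case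
    [theta = 0], where every term is nonnegative and the sum is the integrand
    of [K_m (z0 - z)]. *)
Lemma has_sum_graf (z0 z theta r alpha phi : R) (m : int) :
  0 <= z -> z < z0 -> 0 < r -> `|alpha| < pi / 2 ->
  z0 - z * cos theta = r * cos alpha -> - (z * sin theta) = r * sin alpha ->
  has_sum (fun l : int => besselI l z * cos (l%:~R * theta + phi) *
      besselK (l - m) z0)
    (besselK m r * cos (m%:~R * alpha + phi)).
Proof.
move=> z_ge0 zz0 r0 ha hc hs.
have z00 : 0 < z0 by exact: le_lt_trans zz0.
pose F l t := besselI l z * cos (l%:~R * theta + phi) * besselK_fun (l - m) z0 t.
have cF l : continuous (F l).
  by apply: der_continuous => t; rewrite /F /besselK_fun; eexists; der.
have eF l : exp_decay (F l).
  by apply: exp_decayZ; exact: besselK_fun_decay.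
have iF l : \int[mu]_(t in D) F l t =
    besselI l z * cos (l%:~R * theta + phi) * besselK (l - m) z0.
  by rewrite RintegralZl //; exact: besselK_fun_integrable.
have aligned t : has_sum (fun l : int => besselI l z * besselK_fun (l - m) z0 t)
    (besselK_fun m (z0 - z) t).
  have := has_sum_besselK_fun z0 z t 0 0 m.
  rewrite cos0 sin0 !mulr0 mulr1 oppr0 !addr0 cos0 !mulr1.
  rewrite (_ : _ * _ * _ = besselK_fun m (z0 - z) t); last first.
    rewrite /besselK_fun -expRD; congr (expR _ * _); first by ring.
    by rewrite [RHS]/cosh addrC.
  by apply: eq_has_sum => l; rewrite mulr0 addr0 cos0 mulr1.
have F_le l t : `|F l t| <= besselI l z * besselK_fun (l - m) z0 t.
  rewrite /F normrM [`|besselI _ _ * _|]normrM (ger0_norm (besselI_ge0 _ z_ge0)).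
  rewrite (ger0_norm (besselK_fun_ge0 _ _ _)).
  by rewrite ler_wpM2r ?besselK_fun_ge0 // ler_piMr ?besselI_ge0 // cos_max.
have sum_le (B : seq int) t : uniq B ->
    \sum_(l <- B) `|F l t| <= besselK_fun m (z0 - z) t.
  move=> uB; apply: le_trans (has_sum_ge0 _ (aligned t) uB).
    by apply: ler_sum => l _; exact: F_le.
  by move=> l; rewrite mulr_ge0 ?besselI_ge0 ?besselK_fun_ge0.
have zz : 0 < z0 - z by rewrite subr_gt0.
have [|s hs'] := @sum_bounded_has_sum _ _ (fun l : int => besselI l z *
    cos (l%:~R * theta + phi) * besselK (l - m) z0).
  exists (besselK m (z0 - z)) => B uB.
  have ca l : continuous (fun t => `|F l t|).
    by move=> t; apply: (@continuous_comp _ _ _ (F l) (fun x => `|x|));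
      [exact: cF | exact: norm_continuous].
  have ea l : exp_decay (fun t => `|F l t|).
    by apply: exp_decay_le (eF l) => t _; rewrite normr_id.
  have [cS eS iS] := Rintegral_sum B ca ea.
  apply: (@le_trans _ _ (\sum_(l <- B) \int[mu]_(t in D) `|F l t|)).
    apply: ler_sum => l _; rewrite -iF; apply: le_normr_Rintegral => //.
    exact: integrable_decay.
  rewrite -iS; apply: le_Rintegral => //.
  - exact: integrable_decay.
  - exact: besselK_fun_integrable.
  - by move=> t _; exact: sum_le.
have lim1 := has_sum_int_range hs'.
(* The phase for which the shifted integrand is the sum of the series. *)
pose psi := - phi - m%:~R * alpha.
pose tot t := expR (- (z0 * cosh t)) * expR (z * cosh t * cos theta) *
      ((expR (- (m%:~R * t)) * cos (z * sinh t * sin theta + phi) +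
       expR (m%:~R * t) * cos (- (z * sinh t * sin theta) + phi)) / 2).
have itot : \int[mu]_(t in D) tot t = besselK m r * cos (m%:~R * alpha + phi).
  rewrite (_ : cos _ = cos psi); last by rewrite -cosN /psi opprD addrC.
  rewrite -(Rintegral_contour _ _ r0 ha); apply: eq_Rintegral => t _.
  have h1 (s1 : R) : r * s1 * sin alpha = - (z * s1 * sin theta).
    by rewrite mulrAC -hs; ring.
  rewrite /tot -expRD.
  have -> : - (z0 * cosh t) + z * cosh t * cos theta = - (r * cosh t * cos alpha).
    by rewrite [r * _ * _]mulrAC -hc; ring.
  rewrite /psi.
  rewrite -[cos (z * sinh t * sin theta + phi)]cosN.
  rewrite -[cos (- (z * sinh t * sin theta) + phi)]cosN.
  rewrite !mul1r !mulN1r !mulNr !h1 !opprK !expRD !opprD !opprK.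
  have -> : m%:~R * alpha - z * sinh t * sin theta + (- phi - m%:~R * alpha) =
    - (z * sinh t * sin theta) - phi by ring.
  have -> : m%:~R * alpha + z * sinh t * sin theta + (- phi - m%:~R * alpha) =
    z * sinh t * sin theta - phi by ring.
  by ring.
have cS N : continuous (fun t => \sum_(l <- int_range N) F l t).
  by have [] := Rintegral_sum (int_range N) cF eF.
have ct : continuous tot.
  by apply: der_continuous => t; rewrite /tot; eexists; der.
have dom : [/\ mu.-integrable D (EFin \o tot),
   [sequence \int[mu]_(t in D)
     (`| (\sum_(l <- int_range n) F l t)%:E - (tot t)%:E |)]_n%E @ \oo --> 0%E &
   [sequence \int[mu]_(t in D) (\sum_(l <- int_range n) F l t)%:E]_n%E @ \oo
     --> (\int[mu]_(t in D) (tot t)%:E)%E].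
  apply: (@dominated_convergence _ _ _ mu D _
    (fun n t => (\sum_(l <- int_range n) F l t)%:E) (EFin \o tot)
    (EFin \o besselK_fun m (z0 - z))) => //.
  - move=> n; apply/measurable_EFinP; apply: measurable_funTS.
    by apply: continuous_measurable_fun; exact: cS.
  - apply/measurable_EFinP; apply: measurable_funTS.
    by apply: continuous_measurable_fun; exact: ct.
  - apply: aeW => t _; apply: cvg_EFin; first exact: nearW.
    exact: has_sum_int_range (has_sum_besselK_fun z0 z t theta phi m).
  - exact: besselK_fun_integrable.
  - apply: aeW => t n _; rewrite /= lee_fin.
    apply: le_trans (ler_norm_sum _ _ _) _; apply: sum_le.
    exact: int_range_uniq.
have [it _ lim2] := dom.
have lim3 : (fun N => \sum_(l <- int_range N) besselI l z *
    cos (l%:~R * theta + phi) * besselK (l - m) z0) @ \oo -->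
    \int[mu]_(t in D) tot t.
  rewrite (_ : (fun N => _) = (fun n => fine
     (\int[mu]_(t in D) (\sum_(l <- int_range n) F l t)%:E)%E)); last first.
    apply/funext => N; have [_ _] := Rintegral_sum (int_range N) cF eF.
    by rewrite /Rintegral => ->; apply: eq_bigr => l _; rewrite -iF.
  apply: fine_cvg; rewrite fineK //; exact: integrable_fin_num.
by rewrite -itot -(cvg_unique _ lim1 lim3).
Qed.

End Graf.

Section PolarGraf.
Context {R : realType}.
Implicit Types (t z : R) (m : int).

Lemma expi_neq0 t : expi t != 0 :> R[i].
Proof. by rewrite -normr_eq0 norm_expi oner_eq0. Qed.

Lemma expiN t : expi (- t) = (expi t)^-1 :> R[i].
Proof.
apply: (mulfI (expi_neq0 t)).
by rewrite divff ?expi_neq0 // -expiD subrr expi0.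
Qed.

Lemma expi_mulrn (n : nat) t : expi (n%:R * t) = expi t ^+ n :> R[i].
Proof.
elim: n => [|n IH]; first by rewrite mul0r expi0 expr0.
by rewrite exprS -IH -expiD -natr1; congr expi; ring.
Qed.

Lemma expi_mulrz m t : expi (m%:~R * t) = expi t ^ m :> R[i].
Proof.
case: m => n; first by rewrite -pmulrn expi_mulrn.
by rewrite NegzE mulrNz mulNr expiN -pmulrn expi_mulrn exprnN.
Qed.

(** The aligned case of Graf's theorem, with all terms nonnegative. *)
Lemma besselI_besselK_bound (z0 z : R) m (B : seq int) : 0 <= z -> z < z0 ->
  uniq B -> \sum_(l <- B) besselI l z * besselK (l - m) z0 <= besselK m (z0 - z).
Proof.
move=> z_ge0 zz0 uB.
have pi0 := pi_gt0 R.
have := @has_sum_graf _ z0 z 0 (z0 - z) 0 0 m z_ge0 zz0.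
rewrite subr_gt0 => /(_ zz0); rewrite normr0 cos0 sin0 !mulr0 !mulr1 oppr0.
move=> h; have {h} := h _ erefl erefl; rewrite addr0 cos0 mulr1.
move=> h; apply: le_trans (has_sum_ge0 _ (h _) uB); last by rewrite divr_gt0.
  by apply: ler_sum => l _; rewrite mulr0 addr0 cos0 mulr1.
move=> l; rewrite mulr0 addr0 cos0 mulr1.
by rewrite mulr_ge0 ?besselI_ge0 ?besselK_ge0.
Qed.

Lemma has_sum_grafC (z0 z theta r alpha : R) m :
  0 <= z -> z < z0 -> 0 < r -> `|alpha| < pi / 2 ->
  z0 - z * cos theta = r * cos alpha -> - (z * sin theta) = r * sin alpha ->
  has_sum (fun l : int => (besselK (l - m) z0)%:C *
      ((besselI l z)%:C * expi (l%:~R * theta)))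
    ((besselK m r)%:C * expi (m%:~R * alpha)).
Proof.
move=> h1 h2 h3 h4 h5 h6.
have hre := has_sum_graf 0 m h1 h2 h3 h4 h5 h6.
have him := has_sum_graf (- (pi / 2)) m h1 h2 h3 h4 h5 h6.
have -> : (besselK m r)%:C * expi (m%:~R * alpha) =
    (besselK m r * cos (m%:~R * alpha + 0)) +i*
    (besselK m r * cos (m%:~R * alpha - pi / 2)).
  by rewrite cosBpihalf addr0; apply: complex_eq => /=; ring.
apply: has_sum_complex.
  by apply: eq_has_sum hre => l /=; rewrite addr0; ring.
by apply: eq_has_sum him => l /=; rewrite cosBpihalf; ring.
Qed.

(** A point of the right half plane has an argument in [(- pi/2, pi/2)], the
    range in which the contour may be moved. *)
Lemma polar_right (p q r : R) : 0 < p -> 0 < r -> r ^+ 2 = p ^+ 2 + q ^+ 2 ->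
  exists alpha, [/\ `|alpha| < pi / 2, p = r * cos alpha & q = r * sin alpha].
Proof.
move=> p0 r0 E; exists (asin (q / r)).
have qr : -1 < q / r < 1.
  rewrite -ltr_norml normrM normfV (gtr0_norm r0) ltr_pdivrMr // mul1r.
  rewrite -(ltr_pXn2r (_ : 0 < 2)%N) ?nnegrE ?normr_ge0 ?(ltW r0) //.
  by rewrite real_normK ?num_real // E ltrDr exprn_gt0.
have /andP[qr1 qr2] := qr.
split.
- by rewrite ltr_norml asin_gtNpi2 ?asin_ltpi2 ?qr1 ?qr2 ?(ltW qr1) ?(ltW qr2).
- rewrite cos_asin ?(ltW qr1) ?(ltW qr2) //.
  have -> : 1 - (q / r) ^+ 2 = (p / r) ^+ 2.
    have Ep : p ^+ 2 = r ^+ 2 - q ^+ 2 by rewrite E addrK.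
    by rewrite !expr_div_n Ep; field; rewrite gt_eqF.
  rewrite sqrtr_sqr ger0_norm; last by rewrite divr_ge0 // ltW.
  by rewrite mulrC divfK // gt_eqF.
- rewrite asinK ?in_itv /= ?(ltW qr1) ?(ltW qr2) //.
  by rewrite mulrC divfK // gt_eqF.
Qed.

(** Rotating by [- theta0] and changing the sign of [x - x0] puts the source on
    the positive axis and the target in the right half plane; the factors
    [(-1)^m] and [expi (m theta0)] record this motion. *)
Lemma has_sum_graf_polar (z0 z r theta0 theta theta' : R) m :
  0 <= z -> z < z0 -> 0 <= r ->
  r%:C * expi theta' = z%:C * expi theta - z0%:C * expi theta0 ->
  has_sum (fun l : int => (-1) ^ m * (besselK (l - m) z0)%:C
      * expi (- ((l - m)%:~R * theta0))
      * ((besselI l z)%:C * expi (l%:~R * theta)))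
    ((besselK m r)%:C * expi (m%:~R * theta')).
Proof.
move=> z_ge0 zz0 r_ge0 E.
pose beta := theta - theta0.
have Eb : z0%:C - z%:C * expi beta = - (r%:C * expi theta') * expi (- theta0).
  rewrite E /beta expiD !expiN opprB mulrBl.
  by rewrite -!mulrA divff ?expi_neq0 // mulr1.
have p0 : 0 < z0 - z * cos beta.
  rewrite subr_gt0; apply: le_lt_trans zz0.
  by rewrite ler_piMr // cos_le1.
have Er : r ^+ 2 = (z0 - z * cos beta) ^+ 2 + (- (z * sin beta)) ^+ 2.
  have := congr1 (fun w : R[i] => `|w| ^+ 2) Eb.
  rewrite /= normrM normrN normrM !norm_expi !mulr1 normC_real (ger0_norm r_ge0).
  rewrite -add_Re2_Im2 -rmorphXn => /complexI <- /=.
  by rewrite !mul0r subr0 addr0 sub0r.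
have r0 : 0 < r.
  rewrite lt_neqAle r_ge0 andbT eq_sym; apply/negP => /eqP r0.
  have := ltr_wpDr (sqr_ge0 (- (z * sin beta))) (exprn_gt0 2 p0).
  by rewrite -Er r0 expr0n ltxx.
have [alpha [ha hp hq]] := polar_right p0 r0 Er.
have Ea : expi theta' = - (expi theta0 * expi alpha).
  have rc : r%:C != 0 :> R[i] by rewrite eq_complex /= eqxx andbT gt_eqF.
  apply: (mulfI rc).
  have -> : r%:C * - (expi theta0 * expi alpha) =
      - (r%:C * expi alpha) * expi theta0 by ring.
  have -> : r%:C * expi alpha = z0%:C - z%:C * expi beta.
    by apply: complex_eq; rewrite /= !mul0r ?subr0 ?addr0 ?sub0r -?hp -?hq.
  by rewrite Eb expiN; field; rewrite expi_neq0.
have alg (u a b c d e : R[i]) :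
    u * a * (b * (c * (d * e))) = u * b * (a * e) * (c * d) by ring.
have := has_sumZ ((-1) ^ m * expi (m%:~R * theta0))
  (has_sum_grafC m z_ge0 zz0 r0 ha hp hq).
have -> : (-1) ^ m * expi (m%:~R * theta0) *
    ((besselK m r)%:C * expi (m%:~R * alpha)) =
    (besselK m r)%:C * expi (m%:~R * theta').
  rewrite !expi_mulrz Ea -[- (_ * _)]mulN1r !expfzMl.
  by rewrite mulrCA -mulrA.
apply: eq_has_sum => l /=.
have -> : expi (- ((l - m)%:~R * theta0)) =
    expi (m%:~R * theta0) * expi (- (l%:~R * theta0)).
  by rewrite -expiD intrB; congr expi; ring.
have -> : expi (l%:~R * beta) =
    expi (l%:~R * theta) * expi (- (l%:~R * theta0)).
  by rewrite -expiD; congr expi; rewrite /beta; ring.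
exact: alg.
Qed.

End PolarGraf.

(** * Binomial and logarithmic series *)

Section PowerSeries.
Context {R : realType}.

(** The coefficients of [(1 - x)^-n]; with the truncated predecessor also for
    [n = 0], where only [l = 0] contributes. *)
Definition negbin (n l : nat) : nat := 'C((n + l).-1, l).

Lemma negbin0 n : negbin n 0 = 1%N.
Proof. by rewrite /negbin bin0. Qed.

Lemma negbinS n l : negbin n.+1 l.+1 = (negbin n l.+1 + negbin n.+1 l)%N.
Proof. by rewrite /negbin !addSn !addnS /= binS. Qed.

(** Multiplication by [1 - x] lowers the exponent [n], up to a remainder. *)
Lemma negbin_telescope {K : comNzRingType} (x : K) n N :
  (1 - x) * \sum_(0 <= l < N.+1) (negbin n.+1 l)%:R * x ^+ l =
  \sum_(0 <= l < N.+1) (negbin n l)%:R * x ^+ l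
  - (negbin n.+1 N)%:R * x ^+ N.+1.
Proof.
elim: N => [|N IH].
  by rewrite !big_nat1 !negbin0 expr0 expr1; ring.
rewrite big_nat_recr //= [in RHS]big_nat_recr //= mulrDr IH negbinS natrD !exprS.
by ring.
Qed.

Lemma negbin_sum_le (x : R) n N : 0 <= x -> x < 1 ->
  \sum_(0 <= l < N) (negbin n l)%:R * x ^+ l <= (1 - x) ^- n.
Proof.
move=> x0 x1; have y0 : 0 < 1 - x by rewrite subr_gt0.
have mono k : \sum_(0 <= l < N) (negbin k l)%:R * x ^+ l <=
    \sum_(0 <= l < N.+1) (negbin k l)%:R * x ^+ l.
  by rewrite big_nat_recr //= lerDl mulr_ge0 // exprn_ge0.
apply: le_trans (mono n) _; elim: n => [|n IH].
  rewrite expr0 invr1 big_nat_recl // negbin0 expr0 mulr1 big1 ?addr0 // => l _.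
  by rewrite /negbin add0n /= bin_small // mul0r.
rewrite -(ler_pM2l y0) negbin_telescope [(1 - x) ^+ n.+1]exprS.
rewrite invfM mulVKf ?gt_eqF //.
by apply: le_trans IH; rewrite gerBl mulr_ge0 // exprn_ge0.
Qed.

Lemma has_sum_shift (f : nat -> R[i]) s : has_sum f s ->
  has_sum (fun l => if l is l'.+1 then f l' else 0) s.
Proof.
move=> hf; apply/(@has_sum_reindex _ _ _ succn
  (fun l => if l is l'.+1 then Some l' else None)) => //.
- by case.
- by move=> [|l] // k [->].
Qed.

(** By induction on [n]: the Pascal relation says that multiplication by
    [1 - x], which subtracts a shifted copy, turns the series for [n + 1] into
    the series for [n]. *)
Lemma has_sum_negbin (x : R[i]) n : `|x| < 1 ->
  has_sum (fun l => (negbin n l)%:R * x ^+ l) ((1 - x) ^- n).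
Proof.
move=> x1; have y0 : 1 - x != 0.
  by rewrite subr_eq0; apply/negP => /eqP x1'; rewrite -x1' normr1 ltxx in x1.
elim: n => [|n IH].
  have := @has_sum_fin _ _ (fun l => (negbin 0 l)%:R * x ^+ l) [:: 0%N] isT.
  rewrite big_seq1 negbin0 !expr0 invr1 mulr1; apply => -[|l] //= _.
  by rewrite /negbin add0n /= bin_small // mul0r.
have [|s hs] := @sum_bounded_has_sumC _ _
    (fun l => (negbin n.+1 l)%:R * x ^+ l).
  have nx : `|x| = (complex.Re `|x|)%:C by exact: normC_Re.
  apply: (@sum_bounded_series _ _ ((1 - complex.Re `|x|) ^- n.+1)%:C) => N.
  under eq_bigr => l _.
    rewrite normrM normrX normr_nat nx -rmorphXn /= -(rmorph_nat (real_complex R)).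
    rewrite -rmorphM /=; over.
  rewrite -rmorph_sum lecR; apply: negbin_sum_le.
    by have := normr_ge0 x; rewrite nx ler0c.
  by move: x1; rewrite nx -[1]/(1%:C) ltcR.
suff -> : (1 - x) ^- n.+1 = s by [].
apply: (mulfI y0); rewrite exprS invfM mulVKf //.
apply: has_sum_uniq IH _; rewrite mulrBl mul1r -mulNr.
apply: eq_has_sum (has_sumD hs (has_sumZ (- x) (has_sum_shift hs))) => -[|l] /=.
  by rewrite mulr0 addr0 !negbin0.
by rewrite negbinS natrD exprS; ring.
Qed.

(** The derivatives in [x] of the partial sums and of the logarithm differ by a
    geometric remainder, and the mean value theorem transfers the estimate. *)
Lemma cvg_log_series (x beta : R) : 0 <= x -> x < 1 ->
  series (fun l => x ^+ l * cos (l%:R * beta) / l%:R) @ \oo -->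
  - (ln (1 - 2 * x * cos beta + x ^+ 2) / 2).
Proof.
move=> x0 x1.
pose q (y : R) := 1 - 2 * y * cos beta + y ^+ 2.
have q0 y : 0 <= y -> y < 1 -> (1 - y) ^+ 2 <= q y.
  by move=> y0 y1; have := cos_le1 beta; rewrite /q; nra.
have q_gt0 y : 0 <= y -> y < 1 -> 0 < q y.
  move=> y0 y1; apply: lt_le_trans (q0 y y0 y1).
  by rewrite exprn_gt0 // subr_gt0.
pose S N (y : R) := \sum_(0 <= l < N.+1) y ^+ l * cos (l%:R * beta) / l%:R.
pose dS N (y : R) := \sum_(0 <= l < N) y ^+ l * cos (l.+1%:R * beta).
have hdS N y : derive_at (S N) y (dS N y).
  elim: N => [|N IH].
    have -> : S 0%N = fun=> 0.
      by apply/funext => z; rewrite /S big_nat1 invr0 mulr0.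
    by rewrite /dS big_geq //; exact: der_cst.
  have -> : S N.+1 = fun y => S N y + y ^+ N.+1 * cos (N.+1%:R * beta) / N.+1%:R.
    by apply/funext => z; rewrite /S big_nat_recr.
  rewrite /dS big_nat_recr //=; apply: derD; first exact: IH.
  apply: der_eq.
    apply: (derM (b := 0)); last exact: der_cst.
    by apply: (derM (b := 0)); [der | exact: der_cst].
  by rewrite /= !mulr0 !add0r mulr1 mulrCA mulKf ?pnatr_eq0 // mulrC.
have tele N y : q y * dS N y =
    cos beta - y - y ^+ N * cos (N.+1%:R * beta) + y ^+ N.+1 * cos (N%:R * beta).
  elim: N => [|N IH].
    by rewrite /dS big_geq // mulr0 mul0r cos0 expr0 expr1 !mul1r; ring.
  rewrite /dS big_nat_recr //= mulrDr IH.
  have c2 : cos (N.+2%:R * beta) = 2 * cos beta * cos (N.+1%:R * beta) -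
      cos (N%:R * beta).
    have -> : N.+2%:R * beta = N.+1%:R * beta + beta by rewrite -natr1; ring.
    have -> : N%:R * beta = N.+1%:R * beta - beta by rewrite -natr1; ring.
    by rewrite cosD cosB; ring.
  by rewrite c2 /q !exprS; ring.
pose L (y : R) := ln (q y) / 2.
have hL y : 0 <= y -> y < 1 -> derive_at L y ((y - cos beta) / q y).
  move=> y0 y1; apply: der_eq.
    apply: (derM (b := 0)); last exact: der_cst.
    apply: (@der_comp _ (@ln R) q); last exact: is_derive1_ln (q_gt0 y y0 y1).
    by rewrite /q; der.
  by rewrite /=; field; rewrite gt_eqF // q_gt0.
have bound N : `|S N x + L x| <= (2 / (1 - x) ^+ 2) * x ^+ N.
  have [->|xn0] := eqVneq x 0.
    rewrite /L /q !mulr0 mul0r subr0 expr0n addr0 ln1 mul0r addr0.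
    rewrite /S big_nat_recl // invr0 mulr0 add0r big1 ?normr0.
      by rewrite mulr_ge0 ?exprn_ge0 // divr_ge0 // sqr_ge0.
    by move=> l _; rewrite expr0n /= !mul0r.
  have xp : 0 < x by rewrite lt_neqAle eq_sym xn0.
  pose F y := S N y + L y.
  pose dF y := (- y ^+ N * cos (N.+1%:R * beta) + y ^+ N.+1 * cos (N%:R * beta)) / q y.
  have hF y : 0 <= y -> y < 1 -> derive_at F y (dF y).
    move=> y0 y1; apply: der_eq; first by apply: derD (hdS N y) (hL y y0 y1).
    have qn0 : q y != 0 by rewrite gt_eqF // q_gt0.
    apply: (mulfI qn0); rewrite mulrDr tele /dF ![q y * (_ / q y)]mulrCA.
    by rewrite divff // !mulr1; ring.
  have F0 : F 0 = 0.
    rewrite /F /L /q !mulr0 mul0r subr0 expr0n addr0 ln1 mul0r addr0.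
    rewrite /S big_nat_recl // invr0 mulr0 add0r big1 // => l _.
    by rewrite expr0n /= !mul0r.
  have [||y] := @MVT R F dF 0 x xp.
  - by move=> y; rewrite in_itv /= => /andP[/ltW y0 yx]; apply: hF y0 (lt_trans yx x1).
  - apply: derivable_within_continuous => y; rewrite in_itv /= => /andP[y0 yx].
    exact: derive_at_derivable (hF y y0 (le_lt_trans yx x1)).
  rewrite in_itv /= => /andP[y0 yx]; rewrite F0 !subr0 -/(F x) => ->.
  have qy := q0 y (ltW y0) (lt_trans yx x1).
  have qyp := q_gt0 y (ltW y0) (lt_trans yx x1).
  have yN : y ^+ N <= x ^+ N by rewrite lerXn2r ?nnegrE ?ltW.
  have yN0 : 0 <= y ^+ N by rewrite exprn_ge0 // ltW.
  rewrite normrM /dF normrM normfV (gtr0_norm qyp) (gtr0_norm xp).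
  rewrite -[leRHS]mulr1; apply: ler_pM => //; last exact: ltW.
    by rewrite mulr_ge0 // invr_ge0 ltW.
  rewrite [leRHS]mulrAC; apply: ler_pM; rewrite ?invr_ge0 ?(ltW qyp) //.
    apply: le_trans (ler_normD _ _) _; rewrite mulrDl !mul1r; apply: lerD.
      rewrite normrM normrN (ger0_norm yN0); apply: le_trans yN.
      by rewrite ler_piMr // cos_max.
    rewrite normrM ger0_norm ?exprn_ge0 ?(ltW y0) //; apply: le_trans yN.
    rewrite exprSr -mulrA ler_piMr //; apply: le_trans (ler_norm _) _.
    rewrite normrM normr_id mulr_ile1 // ?cos_max // ger0_norm ?(ltW y0) //.
    exact/ltW/(lt_trans yx).
  rewrite lef_pV2 ?posrE // ?exprn_gt0 ?subr_gt0 //; apply: le_trans qy.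
  by rewrite ler_pXn2r ?nnegrE ?subr_ge0 ?(ltW x1) ?(ltW (lt_trans yx x1)) //; lra.
rewrite -cvg_shiftS /=.
rewrite (_ : (fun n => _) = (fun N => S N x)); last by apply/funext.
apply/subr_cvg0; apply: norm_cvg0.
apply: (@squeeze_cvgr _ _ _ _ (cst 0) (fun N => 2 / (1 - x) ^+ 2 * x ^+ N)).
- by apply: nearW => N; rewrite /= normr_ge0 opprK; exact: bound.
- exact: cvg_cst.
- rewrite -[X in _ --> X](mulr0 (2 / (1 - x) ^+ 2)); apply: cvgMr.
  by apply: cvg_expr; rewrite ger0_norm.
Qed.

End PowerSeries.

(** * Expansion of the harmonic multipoles *)

Section Harmonic.
Context {R : realType}.
Implicit Types (lam rho t : R) (m l : int).

(** What [Qn] adds to [K]: the radial part of a multipole of the Laplace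
    equation. *)
Definition Qharm lam (n : int) rho : R := Qn lam n rho - besselK n (lam * rho).

(** The leading coefficient of [z ^ n K_n z] at [z = 0], for positive [n]. *)
Definition gam (n : nat) : R := 2 ^+ n.-1 * (n.-1)`!%:R.

Lemma Qharm0 lam rho : Qharm lam 0 rho = ln rho.
Proof. by rewrite /Qharm /Qn eqxx addrC addKr. Qed.

Lemma QharmE lam n rho : n != 0 ->
  Qharm lam n rho = - (gam `|n| / (lam * rho) ^+ `|n|).
Proof.
by move=> /negbTE n0; rewrite /Qharm /Qn n0 addrAC subrr add0r exprMn.
Qed.

Lemma gam_gt0 n : 0 < gam n.
Proof. by rewrite mulr_gt0 ?exprn_gt0 // ltr0n fact_gt0. Qed.

(** The expansion coefficients of a harmonic multipole of order [n + 1] are the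
    harmonic radial parts of order [l + n + 1] at the distance of the source. *)
Lemma negbin_gam lam rho0 rho (n l : nat) : 0 < lam -> 0 < rho0 ->
  gam n.+1 / (lam * rho0) ^+ n.+1 * (negbin n.+1 l)%:R * (rho / rho0) ^+ l =
  gam (l + n.+1) / (lam * rho0) ^+ (l + n.+1) *
    ((lam * rho / 2) ^+ l / l`!%:R).
Proof.
move=> lam0 rho00; rewrite /gam addnS /= /negbin addSn /= (addnC n).
have := bin_fact (leq_addr n l); rewrite addKn => E.
have -> : (l + n)`!%:R = ('C(l + n, l))%:R * (l`!%:R * n`!%:R) :> R.
  by rewrite -!natrM E.
rewrite -addnS !exprD !exprMn !exprVn; field.
have f0 k : k`!%:R != 0 :> R by rewrite pnatr_eq0 -lt0n fact_gt0.
by rewrite f0 !expf_neq0 ?pnatr_eq0 // gt_eqF.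
Qed.

Lemma multipole_factor {K : fieldType} (s g L P P' E E' W : K) (n : nat) :
  (P' * E') ^- n = s * (P * E * W) ^- n ->
  s * - (g / (L * P) ^+ n) * E^-1 ^+ n * W ^- n =
  - (g / (L * P') ^+ n) * E'^-1 ^+ n.
Proof.
rewrite !exprMn !invfM !exprVn => h.
transitivity (- (g * L ^- n) * (P' ^- n * E' ^- n)); last by ring.
by rewrite h; ring.
Qed.

(** As [rho' expi t' = - rho0 expi t0 (1 - w)] with
    [w = (rho / rho0) expi (t - t0)], this is the binomial series in [w]. *)
Lemma has_sum_Qharm_nat lam rho0 rho rho' (t0 t t' : R) (n : nat) :
  0 < lam -> 0 <= rho -> rho < rho0 ->
  rho'%:C * expi t' = rho%:C * expi t - rho0%:C * expi t0 ->
  has_sum (fun l : nat => (-1) ^+ n.+1 *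
      (- (gam (l + n.+1) / (lam * rho0) ^+ (l + n.+1)))%:C
      * expi (- t0) ^+ (l + n.+1)
      * (((lam * rho / 2) ^+ l / l`!%:R)%:C * expi t ^+ l))
    ((- (gam n.+1 / (lam * rho') ^+ n.+1))%:C * expi (- t') ^+ n.+1).
Proof.
move=> lam0 rho_ge0 rr0 E.
have rho00 : 0 < rho0 by exact: le_lt_trans rr0.
pose w : R[i] := (rho / rho0)%:C * expi (t - t0).
have w1 : `|w| < 1.
  rewrite normrM norm_expi mulr1 normC_real -[1]/(1%:C) ltcR ger0_norm.
    by rewrite ltr_pdivrMr // mul1r.
  by rewrite divr_ge0 // ltW.
have w0 : 1 - w != 0.
  by rewrite subr_eq0; apply/negP => /eqP x1'; rewrite -x1' normr1 ltxx in w1.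
have rc : rho0%:C != 0 :> R[i] by rewrite eq_complex /= eqxx andbT gt_eqF.
have lc : lam%:C != 0 :> R[i] by rewrite eq_complex /= eqxx andbT gt_eqF.
have Ew : rho'%:C * expi t' = - (rho0%:C * expi t0 * (1 - w)).
  rewrite E /w expiD expiN rmorphM fmorphV /=; field.
  by rewrite rc expi_neq0.
have r'0 : rho'%:C != 0 :> R[i].
  apply/negP => /eqP r0; move: Ew; rewrite r0 mul0r => /esym/eqP.
  by rewrite oppr_eq0 !mulf_eq0 (negbTE rc) (negbTE (expi_neq0 _)) (negbTE w0).
have := has_sumZ ((-1) ^+ n.+1 * (- (gam n.+1 / (lam * rho0) ^+ n.+1))%:C
  * expi (- t0) ^+ n.+1) (has_sum_negbin n.+1 w1).
have -> : (-1) ^+ n.+1 * (- (gam n.+1 / (lam * rho0) ^+ n.+1))%:C *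
    expi (- t0) ^+ n.+1 * (1 - w) ^- n.+1 =
    (- (gam n.+1 / (lam * rho') ^+ n.+1))%:C * expi (- t') ^+ n.+1.
  have : (rho'%:C * expi t') ^- n.+1 =
      (-1) ^+ n.+1 * (rho0%:C * expi t0 * (1 - w)) ^- n.+1.
    by rewrite Ew [(- (_ * _)) ^+ _]exprNn invfM -exprVn invrN1.
  move: (gam n.+1) => g.
  rewrite !rmorphN !rmorphM !fmorphV !rmorphXn !rmorphM /= !expiN.
  exact: multipole_factor.
apply: eq_has_sum => l.
rewrite /w expiD !expiN.
have := @negbin_gam lam rho0 rho n l lam0 rho00.
move: (gam n.+1 / _) (gam (l + n.+1) / _) (_ / l`!%:R) (rho / rho0) => A G P y h.
have hc : A%:C * (negbin n.+1 l)%:R * y%:C ^+ l = G%:C * P%:C.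
  rewrite -[RHS](rmorphM (real_complex R)) -h.
  by rewrite !(rmorphM (real_complex R)) rmorph_nat rmorphXn.
rewrite !exprMn !rmorphN exprD.
move: (y%:C ^+ l) ((negbin n.+1 l)%:R : R[i]) hc => x nb hc.
transitivity (- (-1) ^+ n.+1 * (A%:C * nb * x) * (expi t0)^-1 ^+ n.+1 *
  (expi t ^+ l * (expi t0)^-1 ^+ l)); first by ring.
by rewrite hc; ring.
Qed.

(** The term of order [l] in the expansion of the harmonic multipole of order
    [m]. A negative power of the complex coordinate has a Taylor series, so a
    multipole with [m < 0] uses only [l >= 0], and one with [m > 0] only
    [l <= 0]; the logarithm, [m = 0], uses all [l]. *)
Definition harm_term lam rho0 theta0 rho theta (m l : int) : R[i] :=
  if l * m <= 0 then
    (-1) ^ m * (Qharm lam (l - m) rho0)%:C * expi (- ((l - m)%:~R * theta0))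
    * (((lam * rho / 2) ^+ `|l| / (absz l)`!%:R)%:C * expi (l%:~R * theta))
  else 0.

Lemma has_sum_half {K : numFieldType} (m : int) (f : int -> K) s : m != 0 ->
  has_sum (fun k : nat => f (if m < 0 then k%:Z else - k%:Z)) s ->
  has_sum (fun l => if l * m <= 0 then f l else 0) s.
Proof.
move=> m0 hf.
apply/(@has_sum_reindex _ _ _ (fun k : nat => if m < 0 then k%:Z else - k%:Z)
  (fun l => if l * m <= 0 then Some `|l|%N else None)).
- move=> k; case: (ltP m 0) => hm.
    by rewrite absz_nat ifT //; rewrite mulr_ge0_le0 // ltW.
  by rewrite abszN absz_nat ifT // mulNr oppr_le0 mulr_ge0.
- by move=> l; case: ifP.
- move=> l k; case: ifP => // hlm [<-]; case: (ltP m 0) => hm.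
    by move: hlm; rewrite nmulr_lle0 // => ?; rewrite gez0_abs.
  have {}hm : 0 < m by rewrite lt_neqAle eq_sym m0.
  by move: hlm; rewrite pmulr_lle0 // => ?; rewrite lez0_abs // opprK.
apply: eq_has_sum hf => k /=; case: (ltP m 0) => hm.
  by rewrite ifT //; rewrite mulr_ge0_le0 // ltW.
by rewrite ifT // mulNr oppr_le0 mulr_ge0.
Qed.

Lemma expi_conj (rho' rho rho0 t' t t0 : R) :
  rho'%:C * expi t' = rho%:C * expi t - rho0%:C * expi t0 ->
  rho'%:C * expi (- t') = rho%:C * expi (- t) - rho0%:C * expi (- t0).
Proof.
move=> [h1 h2]; move: h1 h2; rewrite !mul0r !subr0 !addr0 => h1 h2.
by apply: complex_eq; rewrite /= !cosN !sinN !mul0r ?subr0 ?addr0 // !mulrN h2; ring.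
Qed.

Lemma has_sum_harm_term lam rho0 rho rho' (theta0 theta theta' : R) (m : int) :
  m != 0 -> 0 < lam -> 0 <= rho -> rho < rho0 ->
  rho'%:C * expi theta' = rho%:C * expi theta - rho0%:C * expi theta0 ->
  has_sum (harm_term lam rho0 theta0 rho theta m)
    ((Qharm lam m rho')%:C * expi (m%:~R * theta')).
Proof.
move=> m0 lam0 rho_ge0 rr0 E; apply: (has_sum_half m0).
case: m m0 => [[|n]|n] // _ /=.
- have := has_sum_Qharm_nat n lam0 rho_ge0 rr0 (expi_conj E).
  rewrite !opprK QharmE // -pmulrn expi_mulrn absz_nat.
  apply: eq_has_sum => k.
  rewrite QharmE; last by lia.
  have -> : absz (- k%:Z - n.+1%:Z)%R = (k + n.+1)%N by lia.
  have -> : - ((- k%:Z - n.+1%:Z)%:~R * theta0) = (k + n.+1)%:R * theta0.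
    by rewrite -opprD -PoszD mulrNz mulNr opprK -pmulrn.
  have -> : (- k%:Z)%:~R * theta = k%:R * - theta.
    by rewrite mulrNz mulNr mulrN -pmulrn.
  by rewrite !expi_mulrn abszN absz_nat -exprnP.
- have := has_sum_Qharm_nat n lam0 rho_ge0 rr0 E.
  have -> : Qharm lam (Negz n) rho' = - (gam n.+1 / (lam * rho') ^+ n.+1).
    by rewrite QharmE.
  have -> : expi ((Negz n)%:~R * theta') = expi (- theta') ^+ n.+1 :> R[i].
    by rewrite NegzE mulrNz mulNr -mulrN -pmulrn expi_mulrn.
  apply: eq_has_sum => k.
  rewrite QharmE; last by lia.
  have -> : absz (k%:Z - Negz n)%R = (k + n.+1)%N by lia.
  have -> : - ((k%:Z - Negz n)%:~R * theta0) = (k + n.+1)%:R * - theta0.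
    by rewrite NegzE opprK -PoszD mulrN -pmulrn.
  rewrite -pmulrn !expi_mulrn; congr (_ * _ * _ * _).
  by rewrite NegzE -exprnN -exprVn invrN1.
Qed.

Lemma norm_sign (m : int) : `|(-1) ^ m| = 1 :> R[i].
Proof.
case: m => n; first by rewrite -exprnP normrX normrN1 expr1n.
by rewrite NegzE -exprnN normfV normrX normrN1 expr1n invr1.
Qed.

(** The absolute values are the terms of the aligned binomial series. *)
Lemma harm_term_sum_le lam rho0 rho (theta0 theta : R) (m : int) (B : seq int) :
  m != 0 -> 0 < lam -> 0 <= rho -> rho < rho0 -> uniq B ->
  \sum_(l <- B) `|harm_term lam rho0 theta0 rho theta m l| <=
    (gam `|m| / (lam * (rho0 - rho)) ^+ `|m|)%:C.
Proof.
move=> m0 lam0 rho_ge0 rr0 uB.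
have rho00 : 0 < rho0 by exact: le_lt_trans rr0.
case Em : `|m|%N => [|n]; first by move/eqP: Em; rewrite absz_eq0 (negbTE m0).
pose c := gam n.+1 / (lam * rho0) ^+ n.+1.
have x0 : 0 <= rho / rho0 by rewrite divr_ge0 // ltW.
have x1 : rho / rho0 < 1 by rewrite ltr_pdivrMr // mul1r.
have xC : `|(rho / rho0)%:C| < 1 :> R[i].
  by rewrite normC_real -[1]/(1%:C) ltcR ger0_norm.
have := has_sum_Re (has_sum_negbin n.+1 xC).
rewrite -[1 in X in has_sum _ X -> _]/(1%:C) -rmorphB -exprVn -fmorphV -rmorphXn.
rewrite [complex.Re _ in X in has_sum _ X -> _]/=.
move=> /(has_sumZ c) hs.
have := @has_sum_half R m (fun l => c * ((negbin n.+1 `|l|)%:R *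
  (rho / rho0) ^+ `|l|)) (c * (1 - rho / rho0)^-1 ^+ n.+1) m0.
have Ec : c * (1 - rho / rho0)^-1 ^+ n.+1 = gam n.+1 / (lam * (rho0 - rho)) ^+ n.+1.
  rewrite /c exprVn -mulrA -invfM -exprMn; congr (_ / _ ^+ _).
  by field; rewrite gt_eqF.
rewrite {}Ec in hs *; move=> hh; have {}hs := hh (eq_has_sum _ hs).
have norm_term l : `|harm_term lam rho0 theta0 rho theta m l| = (if l * m <= 0
    then c * ((negbin n.+1 `|l|)%:R * (rho / rho0) ^+ `|l|) else 0)%:C.
  rewrite /harm_term; case: ifP => hlm; last by rewrite normr0.
  have lm : absz (l - m)%R = (`|l| + n.+1)%N by rewrite -Em; nia.
  rewrite mulrA /c negbin_gam // QharmE; last by rewrite -absz_eq0 lm addnS.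
  rewrite !normrM !norm_expi !mulr1 norm_sign mul1r.
  rewrite !normC_real -rmorphM /= lm normrN; congr (_%:C).
  rewrite !ger0_norm // divr_ge0 ?ler0n ?exprn_ge0 ?divr_ge0 ?mulr_ge0
    ?(ltW lam0) ?(ltW rho00) ?(ltW (gam_gt0 _)) //.
under eq_bigr do rewrite norm_term.
rewrite sumC lecR; apply: has_sum_ge0 (hs _) uB => [l|k].
  have c0 : 0 <= c.
    apply: divr_ge0; first exact/ltW/gam_gt0.
    by rewrite exprn_ge0 // mulr_ge0 // ltW.
  by case: ifP => // _; rewrite mulr_ge0 // mulr_ge0 // exprn_ge0.
rewrite /= -rmorphXn -(rmorph_nat (real_complex R)) -rmorphM /=.
by case: ifP; rewrite ?abszN absz_nat.
Qed.

Lemma sum_bounded_negbin (x : R) n : 0 <= x -> x < 1 ->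
  sum_bounded (fun l : nat => (negbin n l)%:R * x ^+ l).
Proof.
move=> x0 x1; apply: (@sum_bounded_series _ _ ((1 - x) ^- n)) => N.
apply: le_trans (negbin_sum_le n N x0 x1).
by apply: ler_sum => l _; rewrite ger0_norm // mulr_ge0 // exprn_ge0.
Qed.

Lemma negbin1 (l : nat) : negbin 1 l = 1%N.
Proof. by rewrite /negbin add1n /= binn. Qed.

(** The real series of [cos (l beta) / l] splits evenly between the indices [l]
    and [- l]. *)
Lemma has_sum_log_series (x beta : R) : 0 <= x -> x < 1 ->
  has_sum (fun l : int => (x ^+ `|l| / (2 * `|l|%N%:R))%:C * expi (l%:~R * beta))
    (- (ln (1 - 2 * x * cos beta + x ^+ 2) / 2))%:C.
Proof.
move=> x0 x1.
have x2 (l : nat) : 0 <= x ^+ l / (2 * l%:R) <= x ^+ l.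
  rewrite divr_ge0 ?exprn_ge0 //=; case: l => [|l].
    by rewrite mulr0 invr0 mulr0 exprn_ge0.
  by rewrite ler_piMr ?exprn_ge0 // invf_le1 ?mulr_gt0 // -natrM ler1n.
have bgeom : sum_bounded (fun l : nat => x ^+ l).
  have := sum_bounded_negbin 1 x0 x1; apply: sum_bounded_le => l.
  by rewrite negbin1 mul1r.
pose h (b : R) (l : nat) : R[i] := (x ^+ l / (2 * l%:R))%:C * expi (l%:R * b).
have hsum b : exists s, has_sum (h b) s.
  apply: sum_bounded_has_sumC; apply/sum_bounded_normC.
  apply: sum_bounded_le bgeom => l; rewrite /h normrM norm_expi mulr1 normC_real /=.
  have /andP[h1 h2] := x2 l.
  by rewrite normr_id (ger0_norm h1) ger0_norm // exprn_ge0.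
have [S1 hS1] := hsum beta; have [S2 hS2] := hsum (- beta).
have [|S hS] := @sum_bounded_has_sum _ _
    (fun l : nat => x ^+ l * cos (l%:R * beta) / l%:R).
  apply: sum_bounded_le bgeom => l; rewrite !normrM -mulrA ler_piMr //.
  rewrite mulr_ile1 ?cos_max // normfV normr_nat.
  by case: l => [|l]; rewrite ?invr0 // invf_le1 // ler1n.
have ES : S = - (ln (1 - 2 * x * cos beta + x ^+ 2) / 2).
  exact: (cvg_unique _ (has_sum_series hS) (cvg_log_series x0 x1)).
have ES12 : S1 + S2 = S%:C.
  apply: has_sum_uniq (has_sumD hS1 hS2) _.
  apply: eq_has_sum (has_sum_real_complex hS) => l; rewrite /h mulrN.
  have -> : expi (- (l%:R * beta)) = cos (l%:R * beta) -i* sin (l%:R * beta).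
    by rewrite /expi cosN sinN.
  rewrite invfM.
  by move: (l%:R^-1 : R) => v; apply: complex_eq => /=; [field | ring].
rewrite -ES -ES12.
have hP : has_sum (fun l : int => if l * -1 <= 0 then h beta `|l|%N else 0) S1.
  by apply: has_sum_half => //; apply: eq_has_sum hS1 => l /=; rewrite absz_nat.
have hN : has_sum (fun l : int => if l * 1 <= 0 then h (- beta) `|l|%N else 0) S2.
  by apply: has_sum_half => //; apply: eq_has_sum hS2 => l /=; rewrite abszN absz_nat.
apply: eq_has_sum (has_sumD hP hN) => l; rewrite mulrN1 mulr1 oppr_le0 /h.
(* The index 0 belongs to both half lines, but 1/0 = 0 makes its term vanish. *)
have h0 : (x ^+ 0 / (2 * 0%:R))%:C = 0 :> R[i] by rewrite mulr0 invr0 mulr0.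
case: l => [[|l]|l] /=.
- by rewrite h0 !mul0r addr0.
- by rewrite addr0 -pmulrn.
by rewrite add0r NegzE mulrNz mulNr mulrN -pmulrn.
Qed.

Lemma has_sum_harm_term0 lam rho0 rho rho' (theta0 theta theta' : R) :
  0 < lam -> 0 <= rho -> rho < rho0 -> 0 <= rho' ->
  rho'%:C * expi theta' = rho%:C * expi theta - rho0%:C * expi theta0 ->
  has_sum (harm_term lam rho0 theta0 rho theta 0)
    ((Qharm lam 0 rho')%:C * expi (0%:~R * theta')).
Proof.
move=> lam0 rho_ge0 rr0 rho'_ge0 E.
have rho00 : 0 < rho0 by exact: le_lt_trans rr0.
have x0 : 0 <= rho / rho0 by rewrite divr_ge0 // ltW.
have x1 : rho / rho0 < 1 by rewrite ltr_pdivrMr // mul1r.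
pose beta := theta - theta0; pose x := rho / rho0.
pose q := 1 - 2 * x * cos beta + x ^+ 2.
have q0 : 0 < q.
  apply: (@lt_le_trans _ _ ((1 - x) ^+ 2)); first by rewrite exprn_gt0 // subr_gt0.
  by have := cos_le1 beta; rewrite /q; rewrite -/x in x0 x1; nra.
have Eq : rho' ^+ 2 = rho0 ^+ 2 * q.
  have := congr1 (fun w : R[i] => `|w| ^+ 2) E.
  rewrite /= normrM norm_expi mulr1 normC_real (ger0_norm rho'_ge0).
  rewrite -add_Re2_Im2 -rmorphXn => /complexI -> /=.
  rewrite !mul0r !subr0 !addr0 /q /x /beta cosB.
  have c1 := cos2Dsin2 theta; have c2 := cos2Dsin2 theta0.
  transitivity (rho ^+ 2 * (cos theta ^+ 2 + sin theta ^+ 2) +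
    rho0 ^+ 2 * (cos theta0 ^+ 2 + sin theta0 ^+ 2) -
    2 * rho * rho0 * (cos theta * cos theta0 + sin theta * sin theta0)).
    by ring.
  by rewrite c1 c2; field; rewrite gt_eqF.
have rho'0 : 0 < rho'.
  rewrite lt_neqAle rho'_ge0 andbT eq_sym; apply/negP => /eqP r0.
  by have := mulr_gt0 (exprn_gt0 2 rho00) q0; rewrite -Eq r0 expr0n ltxx.
have Eln : ln rho' = ln rho0 + ln q / 2.
  have := congr1 (@ln R) Eq.
  rewrite lnM ?posrE ?exprn_gt0 // !lnXn // => h; lra.
rewrite Qharm0 mul0r expi0 mulr1.
have hd := @has_sum_fin R[i] _ (fun l : int => if l == 0 then (ln rho0)%:C else 0)
  [:: 0] isT.
rewrite big_seq1 eqxx in hd.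
have {}hd := hd _.
have := has_sumD (hd _) (has_sumZ (-1) (has_sum_log_series beta x0 x1)).
rewrite (_ : (ln rho0)%:C + _ = (ln rho')%:C); last first.
  by rewrite Eln mulN1r -rmorphN opprK -rmorphD.
move=> h; apply: eq_has_sum (h _) => [l|l]; last first.
  by rewrite mem_seq1 => /negbTE ->.
rewrite /harm_term mulr0 lexx expr0z mul1r subr0 -/x.
have [->|l0] := eqVneq l 0.
  have -> : x ^+ `|0%R|%N / (2 * `|0%R|%N%:R) = 0 by rewrite mulr0 invr0 mulr0.
  by rewrite mul0r mulr0 addr0 Qharm0 mulr0z !mul0r oppr0 expi0 expr0 fact0 divr1
    !mulr1.
rewrite add0r QharmE //.
have -> : expi (l%:~R * beta) = expi (- (l%:~R * theta0)) * expi (l%:~R * theta).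
  by rewrite -expiD; congr expi; rewrite /beta; ring.
have : (x ^+ `|l| / (2 * `|l|%N%:R)) = gam `|l| / (lam * rho0) ^+ `|l| *
    ((lam * rho / 2) ^+ `|l| / (absz l)`!%:R).
  case: `|l|%N (absz_eq0 l) => [|n] hn; first by rewrite (negbTE l0) in hn.
  rewrite /gam /x /= factS natrM !exprMn !exprVn [2 ^+ n.+1]exprS; field.
  have f0 : n`!%:R != 0 :> R by rewrite pnatr_eq0 -lt0n fact_gt0.
  by rewrite f0 !expf_neq0 ?pnatr_eq0 // gt_eqF.
move=> ->; rewrite rmorphM rmorphN /=; move: (_ / (lam * rho0) ^+ _) => G.
by ring.
Qed.

End Harmonic.

(** * Growth of K in the order *)

(* Unification would otherwise compare integrals of different orders. *)
#[local] Opaque besselK besselI.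

Section Gap.
Context {R : realType}.
Implicit Types (z : R) (n : nat).

Definition scaledK n z : R := z ^+ n * besselK n z.

Lemma scaledK_ge0 n z : 0 <= z -> 0 <= scaledK n z.
Proof. by move=> z0; rewrite mulr_ge0 ?exprn_ge0 ?besselK_ge0. Qed.

Lemma der_scaledK n z : 0 < z ->
  derive_at (scaledK n) z (- (z ^+ n * besselK (n%:Z - 1) z)).
Proof.
move=> z0; apply: der_eq.
  by apply: derM (besselK_derive n z0); apply: derX; exact: der_id.
have := besselK_recurrence n z0; rewrite -pmulrn => E; rewrite mulr1 /=.
case: n E => [|n] E; last first.
  have -> : besselK n.+1 z * (n.+1%:R * z ^+ n.+1.-1) =
    z ^+ n * (n.+1%:R * besselK n.+1 z) by rewrite /=; ring.
  rewrite E exprS; move: (besselK (_ + 1) z) (besselK (_ - 1) z) => u v.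
  by field.
have -> : besselK (0%:Z + 1) z = besselK (0%:Z - 1) z.
  by rewrite add0r sub0r besselKN.
by rewrite mul0r mulr0 addr0; move: (besselK _ z) => u; field.
Qed.

(** The derivative of [z ^ n K_n z] is [- z ^ n K_(n-1) z]. *)
Lemma scaledK_MVT n (z1 z2 : R) : 0 < z1 -> z1 < z2 -> exists xi,
  [/\ z1 < xi, xi < z2 & scaledK n z1 - scaledK n z2 =
    (z2 - z1) * (xi ^+ n * besselK (n%:Z - 1) xi)].
Proof.
move=> z10 z12.
have [||xi] := @MVT R (scaledK n) (fun z => - (z ^+ n * besselK (n%:Z - 1) z)) _ _ z12.
- by move=> x; rewrite in_itv /= => /andP[h _]; apply: der_scaledK; exact: lt_trans h.
- apply: derivable_within_continuous => x; rewrite in_itv /= => /andP[h _].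
  by apply: derive_at_derivable (der_scaledK n _); exact: lt_le_trans h.
rewrite in_itv /= => /andP[h1 h2] E; exists xi; split => //.
by rewrite -opprB E; ring.
Qed.

Lemma scaledK_anti n (z1 z2 : R) : 0 < z1 -> z1 < z2 -> scaledK n z2 <= scaledK n z1.
Proof.
move=> z10 z12; have [xi [h1 h2 E]] := scaledK_MVT n z10 z12.
rewrite -subr_ge0 E mulr_ge0 ?subr_ge0 ?(ltW z12) //.
by rewrite mulr_ge0 ?besselK_ge0 // exprn_ge0 // ltW // (lt_trans z10).
Qed.

Lemma succ_le_of_recurrence (k : nat -> R) (c : R) : 0 < c ->
  (forall n, 0 < k n) -> (forall n, k n <= k n.+1) ->
  (forall n, k n.+2 = k n + c * n.+1%:R * k n.+1) ->
  exists2 C, 0 < C & forall n, k n.+1 <= C * n.+1%:R * k n.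
Proof.
move=> c0 kp kS krec; have v0 : 0 < k 1%N / k 0%N by rewrite divr_gt0.
exists (1 + c + k 1%N / k 0%N); first by rewrite !addr_gt0.
case=> [|n].
  rewrite mulr1 mulrDl divfK ?gt_eqF // lerDr.
  by rewrite mulr_ge0 ?addr_ge0 ?(ltW c0) // ltW.
rewrite krec; apply: le_trans (lerD (kS n) (lexx _)) _.
rewrite -{1}[k n.+1]mul1r -mulrDl ler_wpM2r ?(ltW (kp _)) //.
have n1 : 0 <= n.+1%:R :> R by [].
by move: (_ / _) v0 => v v0; rewrite -[n.+2%:R]natr1; nra.
Qed.

Lemma besselK_succ_le z : 0 < z ->
  exists2 C, 0 < C & forall n, besselK n.+1 z <= C * n.+1%:R * besselK n z.
Proof.
move=> z0; apply: (@succ_le_of_recurrence (fun n => besselK n z) (2 / z)).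
- by rewrite divr_gt0.
- by move=> n; exact: besselK_gt0.
- by move=> n; exact: besselK_leS.
move=> n; have := besselK_recurrence n.+1 z0; rewrite -pmulrn.
have -> : n.+1%:Z + 1 = n.+2 by lia.
have -> : n.+1%:Z - 1 = n by lia.
move: (besselK n.+2 z) (besselK n.+1 z) (besselK n z) => u v w E.
by rewrite -mulrA E; field; rewrite gt_eqF.
Qed.

(** As functions of [z], [z ^ n K_n z] and a constant are the two parts of a
    multipole of order [n], up to a common factor; for large [n] they are
    asymptotically proportional. The gap is only of relative size [1/n], but
    this suffices to solve for the two coefficients up to a factor [n]. *)
Lemma scaledK_gap (z1 z2 : R) : 0 < z1 -> z1 < z2 ->
  exists2 kappa, 0 < kappa & forall n,
    kappa / n.+1%:R * scaledK n.+1 z2 <= scaledK n.+1 z1 - scaledK n.+1 z2.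
Proof.
move=> z10 z12; have z20 : 0 < z2 by exact: lt_trans z12.
have [C C0 hC] := besselK_succ_le z20.
exists ((z2 - z1) * z1 / (z2 * C)).
  by rewrite divr_gt0 ?mulr_gt0 ?subr_gt0.
move=> n; have [xi [h1 h2 ->]] := scaledK_MVT n.+1 z10 z12.
have -> : n.+1%:Z - 1 = n by lia.
have xi0 : 0 < xi by exact: lt_trans h1.
have hx : z1 * scaledK n z2 <= xi ^+ n.+1 * besselK n xi.
  rewrite exprS -mulrA; apply: ler_pM (ltW z10) _ (ltW h1) _.
    exact/scaledK_ge0/ltW.
  exact: scaledK_anti.
apply: le_trans (_ : (z2 - z1) * (z1 * scaledK n z2) <= _); last first.
  by rewrite ler_wpM2l // subr_ge0 ltW.
have hK : scaledK n.+1 z2 <= z2 * C * n.+1%:R * scaledK n z2.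
  rewrite /scaledK exprS.
  have -> : z2 * C * n.+1%:R * (z2 ^+ n * besselK n z2) =
    z2 * z2 ^+ n * (C * n.+1%:R * besselK n z2) by ring.
  by rewrite ler_wpM2l // mulr_ge0 ?exprn_ge0 ?(ltW z20).
have D0 : 0 < z2 * C * n.+1%:R by rewrite !mulr_gt0.
have -> : (z2 - z1) * z1 / (z2 * C) / n.+1%:R * scaledK n.+1 z2 =
   ((z2 - z1) * z1) * (scaledK n.+1 z2 / (z2 * C * n.+1%:R)).
  by rewrite [(z2 * C * _)^-1]invfM; ring.
rewrite [leRHS]mulrA ler_wpM2l //; first by rewrite mulr_ge0 ?subr_ge0 // ltW.
by rewrite ler_pdivrMr // mulrC.
Qed.

End Gap.

(** * Separating the two kinds of coefficients *)

Section Coefficients.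
Context {R : realType}.

Lemma Re_real_complex (x : R) : complex.Re x%:C = x.
Proof. by []. Qed.

Lemma sum_bounded_abs (f : nat -> R) : sum_bounded f ->
  sum_bounded (fun m : int => f `|m|%N).
Proof.
move=> bf; have [|s hs] := @sum_bounded_has_sum _ _ (fun n => `|f n|).
  by apply: sum_bounded_le bf => n; rewrite normr_id.
have hP : has_sum (fun l : int => if l * -1 <= 0 then `|f `|l|%N| else 0) s.
  by apply: has_sum_half => //; apply: eq_has_sum hs => l /=; rewrite absz_nat.
have hN : has_sum (fun l : int => if l * 1 <= 0 then `|f `|l|%N| else 0) s.
  by apply: has_sum_half => //; apply: eq_has_sum hs => l /=; rewrite abszN absz_nat.
have := sum_boundedD (has_sum_bounded hP) (has_sum_bounded hN).
apply: sum_bounded_le => l; rewrite mulrN1 mulr1 oppr_le0.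
case: (leP 0 l) => h1; last first.
  by rewrite (ltW h1) add0r normr_id.
rewrite [leRHS]ger0_norm; last by rewrite addr_ge0 //; case: ifP.
by rewrite lerDl; case: ifP.
Qed.

Lemma sum_bounded_geom1 (q : R) : 0 <= q -> q < 1 ->
  sum_bounded (fun m : int => (`|m|.+1)%:R * q ^+ `|m|).
Proof.
move=> q0 q1; apply: (@sum_bounded_abs (fun n => n.+1%:R * q ^+ n)).
apply: sum_bounded_le (sum_bounded_negbin 2 q0 q1) => l.
by rewrite /negbin add2n /= binSn.
Qed.

(** At each nonzero order, the values of the multipole at two radii form a linear
    system for the two coefficients, whose determinant is bounded below by the
    gap of [z ^ n K_n z]. *)
Lemma multipole_bounds (lam r1 r2 M : R) (A a : int -> R[i]) :
  0 < lam -> 0 < r1 -> r1 < r2 ->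
  (forall m, `|A m * (besselK m (lam * r1))%:C + a m * (Qharm lam m r1)%:C| <= M%:C) ->
  (forall m, `|A m * (besselK m (lam * r2))%:C + a m * (Qharm lam m r2)%:C| <= M%:C) ->
  exists2 C, 0 <= C & forall m : int, m != 0 ->
   [/\ `|A m| * (scaledK `|m| (lam * r2))%:C <=
         (C * `|m|%:R * (lam * r2) ^+ `|m|)%:C &
       `|a m| * (gam `|m|)%:C <= (C * `|m|%:R * (lam * r2) ^+ `|m|)%:C].
Proof.
move=> lam0 r10 r12 hT1 hT2.
set z1 := lam * r1 in hT1 *; set z2 := lam * r2 in hT2 *.
have z10 : 0 < z1 by rewrite mulr_gt0.
have z12 : z1 < z2 by rewrite ltr_pM2l.
have z20 : 0 < z2 by exact: lt_trans z12.
have [kappa k0 gap] := scaledK_gap z10 z12.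
have M0 : 0 <= M by have := le_trans (normr_ge0 _) (hT1 0); rewrite ler0c.
exists (2 * M / kappa + M); first by rewrite addr_ge0 // divr_ge0 ?(ltW k0) // mulr_ge0.
move=> m m0; case Em : `|m|%N => [|n].
  by move/eqP: Em; rewrite absz_eq0 (negbTE m0).
have {}gap := gap n.
have hQ z r : z = lam * r -> 0 < z ->
    (z ^+ n.+1)%:C * (A m * (besselK m z)%:C + a m * (Qharm lam m r)%:C) =
    A m * (scaledK n.+1 z)%:C - a m * (gam n.+1)%:C.
  move=> Ez zp; rewrite QharmE // Em -Ez -besselK_abs Em /scaledK.
  have zn : z ^+ n.+1 != 0 by rewrite expf_neq0 // gt_eqF.
  move: (gam n.+1) (besselK n.+1 z) (z ^+ n.+1) zn => g K w wn.
  have wc : w%:C != 0 :> R[i] by rewrite eq_complex /= eqxx andbT.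
  by rewrite rmorphN !rmorphM fmorphV /=; field.
have {}hT1 := hT1 m; have {}hT2 := hT2 m.
have {}hQ1 := hQ z1 r1 erefl z10; have {hQ}hQ2 := hQ z2 r2 erefl z20.
set T1 := A m * _ + _ in hT1 hQ1; set T2 := A m * _ + _ in hT2 hQ2.
set h1 := scaledK n.+1 z1 in gap hQ1; set h2 := scaledK n.+1 z2 in gap hQ2 *.
have h2_ge0 : 0 <= h2 by apply: scaledK_ge0; exact: ltW.
set al := complex.Re `|A m|.
have Eal : `|A m| = al%:C by exact: normC_Re.
have al0 : 0 <= al by have := normr_ge0 (A m); rewrite Eal ler0c.
have zz : z1 ^+ n.+1 <= z2 ^+ n.+1 by rewrite lerXn2r ?nnegrE ?ltW.
have zn0 : 0 <= z1 ^+ n.+1 by rewrite exprn_ge0 // ltW.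
have nT1 : `|(z1 ^+ n.+1)%:C * T1| <= (z2 ^+ n.+1 * M)%:C.
  rewrite normrM normC_real (ger0_norm zn0) rmorphM.
  by apply: ler_pM => //; rewrite ?ler0c ?lecR.
have nT2 : `|(z2 ^+ n.+1)%:C * T2| <= (z2 ^+ n.+1 * M)%:C.
  rewrite normrM normC_real (ger0_norm (le_trans zn0 zz)) rmorphM.
  by apply: ler_wpM2l => //; rewrite ler0c (le_trans zn0 zz).
have n1 : 0 < n.+1%:R :> R by rewrite ltr0n.
have D0 : 0 <= h1 - h2.
  by apply: le_trans gap; rewrite mulr_ge0 // divr_ge0 // ltW.
have hD : al * (h1 - h2) <= 2 * (z2 ^+ n.+1 * M).
  have : `|A m * (h1 - h2)%:C| <= (2 * (z2 ^+ n.+1 * M))%:C.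
    rewrite rmorphB mulrBr.
    have -> : A m * h1%:C - A m * h2%:C =
        (z1 ^+ n.+1)%:C * T1 - (z2 ^+ n.+1)%:C * T2 by rewrite hQ1 hQ2; ring.
    apply: le_trans (ler_normB _ _) _; apply: le_trans (lerD nT1 nT2) _.
    by rewrite -rmorphD lecR; lra.
  by rewrite normrM Eal normC_real (ger0_norm D0) -rmorphM lecR.
have hA : al * h2 <= 2 * M / kappa * n.+1%:R * z2 ^+ n.+1.
  have h : al * (kappa / n.+1%:R * h2) <= 2 * (z2 ^+ n.+1 * M).
    by apply: le_trans hD; rewrite ler_wpM2l.
  have -> : al * h2 = al * (kappa / n.+1%:R * h2) * (n.+1%:R / kappa).
    by field; rewrite !gt_eqF.
  have -> : 2 * M / kappa * n.+1%:R * z2 ^+ n.+1 =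
      2 * (z2 ^+ n.+1 * M) * (n.+1%:R / kappa) by field; rewrite gt_eqF.
  by rewrite ler_wpM2r // divr_ge0 // ltW.
have z2n : 0 <= z2 ^+ n.+1 by exact: le_trans zz.
have n1' : 1 <= n.+1%:R :> R by rewrite ler1n.
have Mz : z2 ^+ n.+1 * M <= M * n.+1%:R * z2 ^+ n.+1.
  by rewrite mulrC ler_wpM2r // ler_peMr.
have E : (2 * M / kappa + M) * n.+1%:R * z2 ^+ n.+1 =
    2 * M / kappa * n.+1%:R * z2 ^+ n.+1 + M * n.+1%:R * z2 ^+ n.+1 by ring.
split.
  rewrite Eal -rmorphM lecR E; apply: le_trans hA _.
  by rewrite lerDl !mulr_ge0.
have : `|a m * (gam n.+1)%:C| <=
    ((2 * M / kappa + M) * n.+1%:R * z2 ^+ n.+1)%:C; last first.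
  by rewrite normrM normC_real (ger0_norm (ltW (gam_gt0 _))).
have -> : a m * (gam n.+1)%:C = A m * h2%:C - (z2 ^+ n.+1)%:C * T2.
  by rewrite hQ2; ring.
apply: le_trans (ler_normB _ _) _.
rewrite normrM Eal normC_real (ger0_norm h2_ge0) -rmorphM.
apply: le_trans (lerD (lexx _) nT2) _.
by rewrite -rmorphD lecR E lerD.
Qed.

(** [z ^ n K_n z] decreases in [z], so passing from [r2] to a larger radius [s]
    gains the geometric factor [(r2 / s) ^ n], which absorbs the factor [n]. *)
Lemma scaledK_sum_bounded (lam r2 s C : R) (A : int -> R[i]) :
  0 < lam -> 0 < r2 -> r2 < s -> 0 <= C ->
  (forall m : int, m != 0 -> `|A m| * (scaledK `|m| (lam * r2))%:C <=
         (C * `|m|%:R * (lam * r2) ^+ `|m|)%:C) ->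
  sum_bounded (fun m => A m * (besselK m (lam * s))%:C).
Proof.
move=> lam0 r20 r2s C0 hA; set z2 := lam * r2 in hA; set z := lam * s.
have z20 : 0 < z2 by rewrite mulr_gt0.
have z2z : z2 < z by rewrite ltr_pM2l.
have z0 : 0 < z by exact: lt_trans z2z.
(* The order 0, to which the bound does not apply, is a single term. *)
pose C' := C + complex.Re `|A 0| * besselK 0 z.
have A0 m : 0 <= complex.Re `|A m|.
  by have := normr_ge0 (A m); rewrite normC_Re ler0c.
have C'0 : 0 <= C' by rewrite addr_ge0 // mulr_ge0 ?besselK_ge0.
have q0 : 0 <= z2 / z by rewrite divr_ge0 // ltW.
have q1 : z2 / z < 1 by rewrite ltr_pdivrMr // mul1r.
apply/sum_bounded_normC.
have := sum_boundedZ C' (sum_bounded_geom1 q0 q1).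
apply: sum_bounded_le => m.
rewrite normrM normC_real (ger0_norm (besselK_ge0 _ _)) (normC_Re (A m)).
rewrite -rmorphM Re_real_complex ger0_norm ?mulr_ge0 ?besselK_ge0 //.
rewrite [leRHS]ger0_norm ?mulr_ge0 ?exprn_ge0 //.
have [->|m0] := eqVneq m 0.
  by rewrite absz0 expr0 !mulr1 /C' lerDr.
have := hA m m0; rewrite (normC_Re (A m)) -rmorphM lecR.
rewrite -(besselK_abs m); move: `|m|%N (complex.Re _) (A0 m) => n al al0 h.
have h1 : al * scaledK n z <= al * scaledK n z2.
  by rewrite ler_wpM2l // scaledK_anti.
have zn : 0 < z ^+ n by rewrite exprn_gt0.
rewrite -(ler_pM2r zn) expr_div_n.
have -> : C' * (n.+1%:R * (z2 ^+ n / z ^+ n)) * z ^+ n = C' * n.+1%:R * z2 ^+ n.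
  by field; rewrite gt_eqF.
have -> : al * besselK n z * z ^+ n = al * scaledK n z by rewrite /scaledK; ring.
apply: le_trans h1 _; apply: le_trans h _.
rewrite ler_wpM2r ?exprn_ge0 ?(ltW z20) // ler_pM // ?ler_nat //.
by rewrite /C' lerDl mulr_ge0 ?besselK_ge0.
Qed.

Lemma gam_sum_bounded (lam r2 s C : R) (a : int -> R[i]) :
  0 < lam -> 0 < r2 -> r2 < s -> 0 <= C ->
  (forall m : int, m != 0 -> `|a m| * (gam `|m|)%:C <=
         (C * `|m|%:R * (lam * r2) ^+ `|m|)%:C) ->
  sum_bounded (fun m => if m == 0 then 0 else
    a m * (gam `|m| / (lam * s) ^+ `|m|)%:C).
Proof.
move=> lam0 r20 r2s C0 ha; set z2 := lam * r2 in ha; set z := lam * s.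
have z20 : 0 < z2 by rewrite mulr_gt0.
have z2z : z2 < z by rewrite ltr_pM2l.
have z0 : 0 < z by exact: lt_trans z2z.
have q0 : 0 <= z2 / z by rewrite divr_ge0 // ltW.
have q1 : z2 / z < 1 by rewrite ltr_pdivrMr // mul1r.
apply/sum_bounded_normC.
have := sum_boundedZ C (sum_bounded_geom1 q0 q1).
apply: sum_bounded_le => m.
rewrite [leRHS]ger0_norm ?mulr_ge0 ?exprn_ge0 //.
have [_|m0] := eqVneq m 0.
  by rewrite normr0 /= normr0 !mulr_ge0 ?exprn_ge0.
have g0 n : 0 <= gam n / z ^+ n.
  by rewrite divr_ge0 ?exprn_ge0 ?(ltW (gam_gt0 _)) // ltW.
have A0 : 0 <= complex.Re `|a m|.
  by have := normr_ge0 (a m); rewrite normC_Re ler0c.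
rewrite normrM normC_real (ger0_norm (g0 _)) (normC_Re (a m)).
rewrite -rmorphM Re_real_complex ger0_norm; last exact: mulr_ge0 (g0 _).
have := ha m m0; rewrite (normC_Re (a m)) -rmorphM lecR.
move: `|m|%N (complex.Re _) A0 => n al al0 h.
have zn : 0 < z ^+ n by rewrite exprn_gt0.
rewrite -(ler_pM2r zn) expr_div_n.
have -> : C * (n.+1%:R * (z2 ^+ n / z ^+ n)) * z ^+ n = C * n.+1%:R * z2 ^+ n.
  by field; rewrite gt_eqF.
have -> : al * (gam n / z ^+ n) * z ^+ n = al * gam n by field; rewrite gt_eqF.
apply: le_trans h _.
by rewrite ler_wpM2r ?exprn_ge0 ?(ltW z20) // ler_wpM2l // ler_nat.
Qed.

End Coefficients.

(** * The double family *)

Section Assembly.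
Context {R : realType}.
Implicit Types (lam rho theta : R) (l m : int) (a b A : int -> R[i]).

Lemma cvg_series_term_le (u : nat -> R[i]) (s : R[i]) k : (forall n, 0 <= u n) ->
  series (u : nat -> R[i]^o) @ \oo --> (s : R[i]^o) -> u k <= `|s| + 1.
Proof.
move=> u0 /cvgrPdist_le/(_ 1 ltr01)[N _ hN].
have := hN (maxn N k.+1) (leq_maxl _ _).
set n := maxn N k.+1 => h.
have kn : (k < n)%N by exact: leq_maxr.
have hk : u k <= series (u : nat -> R[i]^o) n.
  rewrite /series /= (bigD1_seq k) ?iota_uniq ?mem_index_iota //= lerDl.
  exact: sumr_ge0.
have S0 : 0 <= series (u : nat -> R[i]^o) n by exact: sumr_ge0.
apply: le_trans hk _; rewrite -(ger0_norm S0) -[in leLHS](subKr s (series _ n)).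
by apply: le_trans (ler_normB _ _) _; rewrite lerD2l.
Qed.

Lemma abs_summable_Z_bounded (f : int -> R[i]) : abs_summable_Z f ->
  exists M : R, forall l, `|f l| <= M%:C.
Proof.
move=> [s [s1 [s2 [h1 h2 _]]]].
exists (complex.Re (`|s1| + 1 + (`|s2| + 1))) => l.
have pos (t : R[i]) : 0 <= `|t| + 1 by rewrite addr_ge0.
rewrite RRe_real; last by apply: ger0_real; rewrite addr_ge0.
case: (leP 0 l) => hl.
  have := @cvg_series_term_le (fun k => `|f (0 + k%:Z)|) s2 `|l|%N
    (fun=> normr_ge0 _) h2.
  by rewrite add0r gez0_abs // => /le_trans; apply; rewrite lerDr.
have := @cvg_series_term_le (fun k => `|f (-1 - k%:Z)|) s1 (`|l|.-1)%N
  (fun=> normr_ge0 _) h1.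
have -> : -1 - (`|l|.-1)%N%:Z = l by lia.
by move=> /le_trans; apply; rewrite lerDl.
Qed.

Lemma QnE lam n rho : Qn lam n rho = Qharm lam n rho + besselK n (lam * rho).
Proof. by rewrite /Qharm subrK. Qed.

(** The expansion converges absolutely at every distance larger than [Rad], so
    its terms are bounded at two radii between [Rad] and [s]. This bounds both
    kinds of coefficients, and the passage to the larger radius [s] makes the
    bounds summable. *)
Lemma expansion_bounds lam (x0 : R * R) Rad phi a b s :
  0 < lam -> 0 < Rad -> Rad < s ->
  is_multipole_expansion lam x0 Rad a b phi ->
  sum_bounded (fun m => (a m + b m) * (besselK m (lam * s))%:C) /\
  sum_bounded (fun m => if m == 0 then 0 else
    a m * (gam `|m| / (lam * s) ^+ `|m|)%:C).
Proof.
move=> lam0 Rad0 Rads hphi.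
have bd r : Rad < r -> exists M : R, forall m,
    `|(a m + b m) * (besselK m (lam * r))%:C + a m * (Qharm lam m r)%:C| <= M%:C.
  move=> Rr; have r0 : 0 < r by exact: lt_trans Rr.
  have [||habs _] := hphi (x0 + (r, 0)) r 0.
  - apply/negP; rewrite /disk /= /enorm addrAC subrr add0r /= expr0n addr0.
    by rewrite sqrtr_sqr (gtr0_norm r0) -ltNge.
  - split; first exact: ltW.
    by rewrite addrAC subrr add0r cos0 sin0 mulr1 mulr0.
  have [M hM] := abs_summable_Z_bounded habs; exists M => m.
  have := hM m; rewrite mulr0 expi0 mulr1 QnE rmorphD /=.
  by congr (`|_| <= _); ring.
(* Two radii to solve at, and a third one to gain a geometric factor. *)
pose r1 := (2 * Rad + s) / 3; pose r2 := (Rad + 2 * s) / 3.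
have [h1 h2 h3] : [/\ Rad < r1, r1 < r2 & r2 < s].
  by rewrite /r1 /r2; split; lra.
have r10 : 0 < r1 by exact: lt_trans h1.
have r20 : 0 < r2 by exact: lt_trans h2.
have [M1 hM1] := bd r1 h1; have [M2 hM2] := bd r2 (lt_trans h1 h2).
have [||C C0 hC] := @multipole_bounds R lam r1 r2 (Num.max M1 M2) (fun m => a m + b m) a
  lam0 r10 h2.
- by move=> m; apply: le_trans (hM1 m) _; rewrite lecR le_max lexx.
- by move=> m; apply: le_trans (hM2 m) _; rewrite lecR le_max lexx orbT.
split.
  by apply: (@scaledK_sum_bounded _ lam r2 s C) => // m /hC[].
by apply: (@gam_sum_bounded _ lam r2 s C) => // m /hC[].
Qed.

Definition graf_term lam rho0 theta0 rho theta m l : R[i] :=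
  (-1) ^ m * (besselK (l - m) (lam * rho0))%:C * expi (- ((l - m)%:~R * theta0))
  * ((besselI l (lam * rho))%:C * expi (l%:~R * theta)).

Section Family.
Variables (lam rho0 theta0 rho theta : R) (A a : int -> R[i]).
Hypotheses (lam0 : 0 < lam) (rho_ge0 : 0 <= rho) (rr0 : rho < rho0).
Hypothesis bA : sum_bounded (fun m => A m * (besselK m (lam * (rho0 - rho)))%:C).
Hypothesis ba : sum_bounded (fun m => if m == 0 then 0 else
    a m * (gam `|m| / (lam * (rho0 - rho)) ^+ `|m|)%:C).

(** The rows are bounded by the aligned case, and the row bounds are summable
    because [rho0 - rho] exceeds the radius. *)
Lemma graf_family_bounded : sum_bounded (fun p : int * int =>
  A p.1 * graf_term lam rho0 theta0 rho theta p.1 p.2).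
Proof.
have z_ge0 : 0 <= lam * rho by rewrite mulr_ge0 // ltW.
have zz0 : lam * rho < lam * rho0 by rewrite ltr_pM2l.
apply: (@sum_bounded_prod _ _ _ _
  (fun m => `|A m| * (besselK m (lam * (rho0 - rho)))%:C)).
  move=> m B uB /=; under eq_bigr => l _.
    rewrite normrM /graf_term !normrM !norm_expi norm_sign !mulr1 mul1r.
    rewrite !normC_real (ger0_norm (besselK_ge0 _ _)).
    rewrite (ger0_norm (besselI_ge0 _ z_ge0)) -rmorphM mulrC.
    rewrite [besselK _ _ * _]mulrC; over.
  rewrite -mulr_suml sumC mulrC; apply: ler_wpM2l => //.
  by rewrite lecR mulrBr; exact: besselI_besselK_bound.
apply: sum_bounded_le bA => m.
by rewrite !normrM normr_id.
Qed.

Lemma harm_family_bounded rho' theta' : 0 <= rho' ->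
  rho'%:C * expi theta' = rho%:C * expi theta - rho0%:C * expi theta0 ->
  sum_bounded (fun p : int * int =>
    a p.1 * harm_term lam rho0 theta0 rho theta p.1 p.2).
Proof.
move=> rho'_ge0 E.
have [M0 hM0] := has_sum_bounded (has_sum_harm_term0 lam0 rho_ge0 rr0 rho'_ge0 E).
pose G m := (if m == 0 then `|a 0| * M0 else 0) + `|(if m == 0 then 0 else
    a m * (gam `|m| / (lam * (rho0 - rho)) ^+ `|m|)%:C)|.
apply: (@sum_bounded_prod _ _ _ _ G).
  move=> m B uB /=; under eq_bigr do rewrite normrM; rewrite -mulr_sumr /G.
  have [->|m0] := eqVneq m 0.
    by rewrite normr0 addr0; apply: ler_wpM2l => //; exact: hM0.
  rewrite add0r normrM normC_real; apply: ler_wpM2l => //.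
  apply: le_trans (harm_term_sum_le theta0 theta m0 lam0 rho_ge0 rr0 uB) _.
  by rewrite lecR ler_norm.
apply: sum_boundedD.
  have h := @has_sum_fin _ _ (fun m : int => if m == 0 then `|a 0| * M0 else 0)
    [:: 0] isT.
  apply: has_sum_bounded (h _) => m.
  by rewrite mem_seq1 => /negbTE ->.
by apply: sum_bounded_le ba => m; rewrite normr_id.
Qed.

End Family.

(** [x - x0] is [- expi theta0] times a point of the right half plane. *)
Lemma polar_difference rho0 rho theta0 theta : 0 <= rho -> rho < rho0 ->
  exists rho' theta' : R, rho0 - rho <= rho' /\
    rho'%:C * expi theta' = rho%:C * expi theta - rho0%:C * expi theta0.
Proof.
move=> rho_ge0 rr0; pose beta := theta - theta0.
pose p := rho0 - rho * cos beta; pose q := - (rho * sin beta).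
have p0 : 0 < p.
  by rewrite subr_gt0; apply: le_lt_trans rr0; rewrite ler_piMr // cos_le1.
have pq0 : 0 < p ^+ 2 + q ^+ 2 by rewrite ltr_wpDr ?sqr_ge0 // exprn_gt0.
have r0 : 0 < Num.sqrt (p ^+ 2 + q ^+ 2) by rewrite sqrtr_gt0.
have [|alpha [_ hp hq]] := @polar_right _ p q (Num.sqrt (p ^+ 2 + q ^+ 2)) p0 r0.
  by rewrite sqr_sqrtr // ltW.
set r := Num.sqrt _ in r0 hp hq.
have E : r%:C * expi (theta0 + alpha + pi) =
    rho%:C * expi theta - rho0%:C * expi theta0.
  have epi : expi pi = -1 :> R[i].
    by apply: complex_eq; rewrite /= ?cospi ?sinpi ?oppr0.
  rewrite (expiD (theta0 + alpha)) epi (expiD theta0).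
  have -> : r%:C * (expi theta0 * expi alpha * -1) =
      - (r%:C * expi alpha) * expi theta0 by ring.
  have -> : r%:C * expi alpha = rho0%:C - rho%:C * expi beta.
    by apply: complex_eq; rewrite /= !mul0r ?subr0 ?addr0 ?sub0r -?hp -?hq.
  by rewrite /beta expiD expiN; field; exact: expi_neq0.
exists r, (theta0 + alpha + pi); split => //.
have := congr1 (fun w : R[i] => `|w|) E.
rewrite /= normrM norm_expi mulr1 normC_real (gtr0_norm r0) => En.
rewrite -lecR En distrC rmorphB.
apply: le_trans (lerB_dist _ _).
rewrite !normrM !norm_expi !mulr1 !normC_real (ger0_norm rho_ge0) ger0_norm //.
exact: le_trans (ltW rr0).
Qed.

End Assembly.

(** * The local expansion *)

Section LocalExpansion.
Context {R : realType}.
Variables (lam rho0 theta0 : R) (a b : int -> R[i]).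

Definition coefK l m : R[i] :=
  (-1) ^ m * (a m + b m) * (besselK (l - m) (lam * rho0))%:C
    * expi (- ((l - m)%:~R * theta0)).

Definition coefQ l m : R[i] :=
  (-1) ^ m * (a m * (Qn lam (l - m) rho0)%:C
              + b m * (besselK (l - m) (lam * rho0))%:C)
    * expi (- ((l - m)%:~R * theta0)).

(** The harmonic part of [coefQ], kept only where it occurs in the local
    expansion: the two ranges of summation in the coefficients [d l] are the
    two signs of [l * m]. *)
Definition coefH l m : R[i] :=
  if l * m <= 0 then
    (-1) ^ m * a m * (Qharm lam (l - m) rho0)%:C * expi (- ((l - m)%:~R * theta0))
  else 0.

Lemma coefQE l m : l * m <= 0 -> coefQ l m = coefK l m + coefH l m.
Proof.
move=> lm; rewrite /coefQ /coefK /coefH lm QnE rmorphD.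
by move: ((-1) ^ m) (expi _) => u v; ring.
Qed.

Definition radialI rho theta l : R[i] :=
  (besselI l (lam * rho))%:C * expi (l%:~R * theta).

Definition radialP rho theta l : R[i] :=
  ((lam * rho / 2) ^+ `|l| / (absz l)`!%:R)%:C * expi (l%:~R * theta).

Lemma graf_termE rho theta m l :
  (a m + b m) * graf_term lam rho0 theta0 rho theta m l =
  coefK l m * radialI rho theta l.
Proof.
rewrite /graf_term /coefK /radialI.
by move: ((-1) ^ m) (expi _) (_ * expi _) => u v w; ring.
Qed.

Lemma harm_termE rho theta m l :
  a m * harm_term lam rho0 theta0 rho theta m l =
  coefH l m * radialP rho theta l.
Proof.
rewrite /harm_term /coefH /radialP; case: ifP => _; last by rewrite mulr0 mul0r.
by move: ((-1) ^ m) (expi _) (_ * expi _) => u v w; ring.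
Qed.

Lemma sum_bounded_column (F : int * int -> R[i]) l : sum_bounded F ->
  sum_bounded (fun m => F (m, l)).
Proof.
move=> [M hM]; exists M => B uB.
have := hM [seq (m, l) | m <- B]; rewrite big_map; apply.
by rewrite map_inj_uniq // => i j [].
Qed.

Lemma sum_boundedZ_inv (f : int -> R[i]) (c : R[i]) : c != 0 ->
  sum_bounded (fun m => f m * c) -> sum_bounded f.
Proof.
move=> c0 /(sum_boundedZ c^-1); apply: sum_bounded_le => m.
by rewrite mulrCA mulVf // mulr1.
Qed.

Lemma polar_enorm (c x : R * R) r t : polar_coords c x r t -> enorm (x - c) = r.
Proof.
move=> [r0 ->]; rewrite /enorm /= !exprMn -mulrDr cos2Dsin2 mulr1.
by rewrite sqrtr_sqr ger0_norm.
Qed.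

(** Up to nonzero factors, the coefficient families are columns of the double
    family at any one point of the inner disk other than its centre. *)
Lemma coef_summable Rad : 0 < lam -> 0 < Rad -> Rad < rho0 ->
  (forall s, Rad < s ->
    sum_bounded (fun m => (a m + b m) * (besselK m (lam * s))%:C) /\
    sum_bounded (fun m => if m == 0 then 0 else
      a m * (gam `|m| / (lam * s) ^+ `|m|)%:C)) ->
  (exists c, forall l, has_sum (coefK l) (c l)) /\
  (exists e, forall l, has_sum (coefH l) (e l)).
Proof.
move=> lam0 Rad0 Rr bd.
(* Any radius strictly between 0 and rho0 - Rad. *)
pose rho := (rho0 - Rad) / 2.
have [rho_gt0 rr0 hs] : [/\ 0 < rho, rho < rho0 & Rad < rho0 - rho].
  by rewrite /rho; split; lra.
have [bA ba] := bd _ hs.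
have [rho' [theta' [hrho' E]]] := polar_difference theta0 0 (ltW rho_gt0) rr0.
have rho'_ge0 : 0 <= rho' by apply: le_trans hrho'; rewrite subr_ge0 ltW.
have bX := graf_family_bounded theta0 0 lam0 (ltW rho_gt0) rr0 bA.
have bY := harm_family_bounded lam0 (ltW rho_gt0) rr0 ba rho'_ge0 E.
have z0 : 0 < lam * rho by rewrite mulr_gt0.
have rc (x : R) : 0 < x -> x%:C != 0 :> R[i].
  by move=> x0; rewrite eq_complex /= eqxx andbT gt_eqF.
split.
  have h l : exists s, has_sum (coefK l) s.
    apply: sum_bounded_has_sumC.
    apply: (@sum_boundedZ_inv _ (radialI rho 0 l)).
      by rewrite mulf_neq0 ?expi_neq0 // rc // besselI_gt0.
    apply: sum_bounded_le (sum_bounded_column l bX) => m.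
    by rewrite /= graf_termE.
  by have [c hc] := choice h; exists c.
have h l : exists s, has_sum (coefH l) s.
  apply: sum_bounded_has_sumC.
  apply: (@sum_boundedZ_inv _ (radialP rho 0 l)).
    by rewrite mulf_neq0 ?expi_neq0 // rc // divr_gt0 ?exprn_gt0 ?divr_gt0 //
      ltr0n fact_gt0.
  apply: sum_bounded_le (sum_bounded_column l bY) => m.
  by rewrite /= harm_termE.
by have [e he] := choice h; exists e.
Qed.

(** The double family at a point of the inner disk is absolutely summable; its
    rows add up to the terms of the multipole expansion, its columns to those
    of the local expansion. *)
Lemma local_expansion Rad rho theta rho' theta' (c e : int -> R[i]) :
  0 < lam -> 0 < Rad -> 0 <= rho -> rho < rho0 - Rad ->
  0 <= rho' ->
  rho'%:C * expi theta' = rho%:C * expi theta - rho0%:C * expi theta0 ->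
  (forall s, Rad < s ->
    sum_bounded (fun m => (a m + b m) * (besselK m (lam * s))%:C) /\
    sum_bounded (fun m => if m == 0 then 0 else
      a m * (gam `|m| / (lam * s) ^+ `|m|)%:C)) ->
  (forall l, has_sum (coefK l) (c l)) -> (forall l, has_sum (coefH l) (e l)) ->
  exists S,
    has_sum (fun m => (a m * (Qn lam m rho')%:C + b m * (besselK m (lam * rho'))%:C)
      * expi (m%:~R * theta')) S /\
    has_sum (fun l => c l * radialI rho theta l + e l * radialP rho theta l) S.
Proof.
move=> lam0 Rad0 rho_ge0 rhoR rho'_ge0 E bd hc he.
have rr0 : rho < rho0 by apply: lt_trans rhoR _; rewrite gtrBl.
have [|bA ba] := bd (rho0 - rho); first by lra.
have [SX hX] := sum_bounded_has_sumC
  (graf_family_bounded theta0 theta lam0 rho_ge0 rr0 bA).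
have [SY hY] := sum_bounded_has_sumC
  (harm_family_bounded lam0 rho_ge0 rr0 ba rho'_ge0 E).
exists (SX + SY); split.
  have zE : (lam * rho')%:C * expi theta' =
      (lam * rho)%:C * expi theta - (lam * rho0)%:C * expi theta0.
    by rewrite !rmorphM -!mulrA E mulrBr !mulrA.
  have zz0 : lam * rho < lam * rho0 by rewrite ltr_pM2l.
  have rowX m : has_sum (fun l => (a m + b m) *
        graf_term lam rho0 theta0 rho theta m l)
      ((a m + b m) * ((besselK m (lam * rho'))%:C * expi (m%:~R * theta'))).
    exact/has_sumZ/(has_sum_graf_polar m (mulr_ge0 (ltW lam0) rho_ge0) zz0
      (mulr_ge0 (ltW lam0) rho'_ge0) zE).
  have rowY m : has_sum (fun l => a m * harm_term lam rho0 theta0 rho theta m l)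
      (a m * ((Qharm lam m rho')%:C * expi (m%:~R * theta'))).
    apply: has_sumZ; have [->|m0] := eqVneq m 0; first exact: has_sum_harm_term0.
    exact: has_sum_harm_term.
  have := has_sumD (has_sum_fubini hX rowX) (has_sum_fubini hY rowY).
  apply: eq_has_sum => m; rewrite QnE.
  move: (besselK _ _) (Qharm _ _ _) (expi _) => u v w.
  by rewrite rmorphD /=; ring.
apply: has_sumD.
  apply: has_sum_fubini2 hX _ => l /=.
  rewrite mulrC; apply: eq_has_sum (has_sumZ (radialI rho theta l) (hc l)) => m.
  by rewrite graf_termE mulrC.
apply: has_sum_fubini2 hY _ => l /=.
rewrite mulrC; apply: eq_has_sum (has_sumZ (radialP rho theta l) (he l)) => m.
by rewrite harm_termE mulrC.
Qed.

End LocalExpansion.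

Theorem lemma8 (R : realType) (lam : R) (x0 : R * R) (rho0 theta0 Rad : R)
    (phi : R * R -> R[i]) (a b : int -> R[i]) :
  0 < lam ->
  polar_coords 0 x0 rho0 theta0 ->
  0 < Rad -> Rad < rho0 ->
  is_potential_of_disk lam x0 Rad phi ->
  is_multipole_expansion lam x0 Rad a b phi ->
  (* the terms of the series defining the coefficients of the expansion *)
  let tK (l m : int) : R[i] :=
    (-1) ^ m * (a m + b m) * (besselK (l - m) (lam * rho0))%:C
      * expi (- ((l - m)%:~R * theta0)) in
  let tQ (l m : int) : R[i] :=
    (-1) ^ m * (a m * (Qn lam (l - m) rho0)%:C
                + b m * (besselK (l - m) (lam * rho0))%:C)
      * expi (- ((l - m)%:~R * theta0)) in
  exists c d : int -> R[i],
    [/\ forall l : int, sum_Z (tK l) (c l),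
        forall l : int, 0 < l -> exists s1 s2 : R[i],
          [/\ sum_le 0 (tQ l) s1, sum_ge 1 (tK l) s2
            & d l = (2 ^+ `|l| * (absz l)`!%:R)^-1 * s1
                    + (2 ^+ `|l| * (absz l)`!%:R)^-1 * s2],
        sum_Z (tQ 0) (d 0),
        forall l : int, l < 0 -> exists s1 s2 : R[i],
          [/\ sum_le (-1) (tK l) s1, sum_ge 0 (tQ l) s2
            & d l = (2 ^+ `|l| * (absz l)`!%:R)^-1 * s1
                    + (2 ^+ `|l| * (absz l)`!%:R)^-1 * s2]
      & forall (x : R * R) (rho theta : R),
          polar_coords 0 x rho theta -> enorm x < rho0 - Rad ->
          sum_Z (fun l : int =>
                   (c l * (Pn lam l rho)%:C + d l * ((lam * rho) ^+ `|l|)%:C)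
                   * expi (l%:~R * theta)) (phi x)].
Proof.
move=> lam0 hx0 Rad0 Rr _ hphi tK tQ.
have bd s : Rad < s -> _ := fun h => expansion_bounds lam0 Rad0 h hphi.
have [[c hc] [e he]] := coef_summable theta0 lam0 Rad0 Rr bd.
pose d l := (2 ^+ `|l| * (absz l)`!%:R)^-1 * (c l + e l).
(* Both ranges of summation for d l come from the one family coefK + coefH. *)
have split_sum l (P : pred int) : l != 0 -> exists s1 s2,
   [/\ has_sum (fun m => if P m then coefK lam rho0 theta0 a b l m +
         coefH lam rho0 theta0 a l m else 0) s1,
       has_sum (fun m => if ~~ P m then coefK lam rho0 theta0 a b l m +
         coefH lam rho0 theta0 a l m else 0) s2 & c l + e l = s1 + s2].
  move=> l0; have h := has_sumD (hc l) (he l).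
  have [s1 h1] := has_sum_restr P h; have [s2 h2] := has_sum_restr (predC P) h.
  exists s1, s2; split => //; apply: has_sum_uniq h _.
  apply: eq_has_sum (has_sumD h1 h2) => m /=.
  by case: (P m); rewrite ?addr0 ?add0r.
exists c, d; split.
- by move=> l; apply: has_sum_Z; exact: hc.
- move=> l l0; have [|s1 [s2 [h1 h2 h12]]] := split_sum l (fun m => m <= 0).
    by rewrite gt_eqF.
  exists s1, s2; split.
  + apply: has_sum_le; apply: eq_has_sum h1 => m /=; case: ifP => // hm.
    by rewrite -coefQE // pmulr_rle0.
  + apply: has_sum_ge; apply: eq_has_sum h2 => m /=; rewrite -ltNge.
    have -> : (1 <= m) = (0 < m) by lia.
    case: ifP => // hm; rewrite /coefH ifF ?addr0 //.
    by rewrite pmulr_rle0 // leNgt hm.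
  + by rewrite /d h12 mulrDr.
- apply: has_sum_Z; rewrite /d expr0 fact0 mulr1 invr1 mul1r.
  apply: eq_has_sum (has_sumD (hc 0) (he 0)) => m /=.
  by rewrite -coefQE // mul0r.
- move=> l l0; have [|s1 [s2 [h1 h2 h12]]] := split_sum l (fun m => m < 0).
    by rewrite lt_eqF.
  exists s1, s2; split.
  + apply: has_sum_le; apply: eq_has_sum h1 => m /=.
    have -> : (m <= -1) = (m < 0) by lia.
    case: ifP => // hm; rewrite /coefH ifF ?addr0 //.
    by rewrite nmulr_rle0 // leNgt hm.
  + apply: has_sum_ge; apply: eq_has_sum h2 => m /=; rewrite -leNgt.
    by case: ifP => // hm; rewrite -coefQE // nmulr_rle0.
  + by rewrite /d h12 mulrDr.
move=> x rho theta hx hxR.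
have rhoE : enorm x = rho by have := polar_enorm hx; rewrite subr0.
rewrite rhoE in hxR; have [rho_ge0 xE] := hx; have [rho00 x0E] := hx0.
rewrite !subr0 in xE x0E.
have rr0 : rho < rho0 by lra.
have [rho' [theta' [hrho' E]]] := polar_difference theta0 theta rho_ge0 rr0.
have rho'R : Rad < rho' by apply: lt_le_trans hrho'; lra.
have rho'_ge0 : 0 <= rho' by exact/ltW/(lt_trans Rad0).
have hx' : polar_coords x0 x rho' theta'.
  split => //; move: E => [E1 E2]; rewrite xE x0E.
  move: E1 E2; rewrite !mul0r !subr0 !addr0 => -> ->.
  by congr pair.
have xdisk : ~ disk x0 Rad x.
  by rewrite /disk /= (polar_enorm hx'); apply/negP; rewrite -ltNge.
have [_ hs] := hphi x rho' theta' xdisk hx'.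
have [S [hS1 hS2]] := local_expansion lam0 Rad0 rho_ge0 hxR rho'_ge0 E bd hc he.
rewrite (sum_Z_uniq hs (has_sum_Z hS1)).
apply: has_sum_Z; apply: eq_has_sum hS2 => l.
rewrite /radialI /radialP /d /Pn.
have f0 : (absz l)`!%:R != 0 :> R by rewrite pnatr_eq0 -lt0n fact_gt0.
have fC : (absz l)`!%:R != 0 :> R[i] by rewrite pnatr_eq0 -lt0n fact_gt0.
have p2 : 2 ^+ `|l| != 0 :> R[i] by rewrite expf_neq0.
rewrite expr_div_n.
move: (besselI _ _) ((lam * rho) ^+ _) => I w.
rewrite rmorphB !rmorphM !fmorphV rmorphXn !rmorph_nat /=.
by field; rewrite p2 fC.
Qed.
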